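(* Let $q=2^n>2$, and let $G=PSp(4,q)$ be the projective symplectic group defined by $W(q)$, acting on the point set $P$ of $PG(3,q)$. Let $\mathcal{D}\subseteq \mathbb{F}_2^{P}$ be the $\mathbb{F}_2G$-submodule generated by the (characteristic functions of) dual grids of $W(q)$. Then the $\mathbb{F}_2G$-radical $U$ of $\mathcal{D}$ is of codimension one in $\mathcal{D}$. Consequently, the sum (in $\mathbb{F}_2^P$) of any two dual grids of $W(q)$ is in $U$.
   Context: Fix a nondegenerate symplectic (alternating) bilinear form on $\mathbb{F}_q^4$. $W(q)$ is the symplectic generalized quadrangle whose points are all points of $PG(3,q)$ (the set of these is denoted $P$) and whose lines are the lines of $PG(3,q)$ that are totally isotropic for this form. For a line $m$ of $PG(3,q)$, $m^{\perp}$ is the line of points orthogonal to all points of $m$. A dual grid of $W(q)$ is a subset of $P$ of the form $m\cup m^{\perp}$, where $m$ is a line of $PG(3,q)$ that is not a line of $W(q)$. The group $G$ is the subgroup $PSp(4,q)$ of $PGL(4,q)$ preserving the form. $\mathbb{F}_2^P$ is the $\mathbb{F}_2G$-permutation module on $P$; a subset of $P$ is identified with its characteristic function in $\mathbb{F}_2^P$. The radical of a module $M$ is the smallest submodule of $M$ with semisimple quotient. *)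

(* Defs.v *)
From HB Require Import structures.
From mathcomp Require Import all_boot all_fingroup all_algebra.
From mathcomp Require Import all_solvable mxrepresentation.

Set Implicit Arguments.
Unset Strict Implicit.
Unset Printing Implicit Defensive.

Import GRing.Theory.
Local Open Scope ring_scope.

(* The subType structure of {vspace vT} is visible only with this Import. *)
Import VectorInternalTheory.
HB.instance Definition _ (F : finFieldType) (vT : vectType F) :=
  [Countable of {vspace vT} by <:].
HB.instance Definition _ (F : finFieldType) (vT : vectType F) :=
  [Finite of {vspace vT} by <:].

Section PermutationModule.

Variables (F : fieldType) (aT : finGroupType) (D : {group aT}) (T : finType).
Variable to : action D T.

(* F^T is identified with 'rV[F]_#|T| through the enumeration of T; the basis
   vector of x is mapped by a to the basis vector of to x a. *)
Definition charv (S : {set T}) : 'rV[F]_#|T| :=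
  \row_i (enum_val i \in S)%:R.

Definition permod_mx (a : aT) : 'M[F]_#|T| :=
  \matrix_(i, j) (to (enum_val i) a == enum_val j)%:R.

Lemma permod_mx_repr (G : {group aT}) : G \subset D -> mx_repr G permod_mx.
Proof.
move=> sGD; split=> [|a b Ga Gb].
  by apply/matrixP=> i j; rewrite !mxE act1 (inj_eq enum_val_inj).
apply/matrixP=> i j; rewrite !mxE (bigD1 (enum_rank (to (enum_val i) a))) //=.
rewrite !mxE enum_rankK eqxx mul1r big1 => [|k ne_k].
  by rewrite addr0 actMin ?(subsetP sGD).
rewrite !mxE; case: eqP => [ek|_]; last by rewrite mul0r.
by rewrite ek enum_valK eqxx in ne_k.
Qed.

Definition permod_repr (G : {group aT}) (sGD : G \subset D) :=
  MxRepresentation (permod_mx_repr sGD).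

Lemma charv_permod (S : {set T}) (a : aT) :
  a \in D -> charv S *m permod_mx a = charv (to^*%act S a).
Proof.
move=> Da; apply/rowP=> j; rewrite !mxE.
have [i0 tK] : exists i0 : 'I_#|T|, enum_val j = to (enum_val i0) a.
  by exists (enum_rank (to (enum_val j) a^-1%g)); rewrite enum_rankK (actKVin to).
rewrite (bigD1 i0) //= !mxE tK eqxx mulr1 big1 => [|k ne_k].
  by rewrite addr0 /= setactE (mem_imset _ _ (act_inj to a)).
rewrite !mxE tK; case: eqP => [/act_inj/enum_val_inj ek|_]; last by rewrite mulr0.
by rewrite ek eqxx in ne_k.
Qed.

End PermutationModule.

Arguments charv F {T} S.
Arguments permod_mx F {aT D T} to a.
Arguments permod_repr F {aT D T} to {G} sGD.

Section Radical.

Variables (F : fieldType) (gT : finGroupType) (G : {group gT}) (n : nat).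
Variable rG : mx_representation F G n.

(* V / U is a semisimple module; mxsemisimple lives in Type. *)
Definition semisimple_quotient (V U : 'M[F]_n) : Prop :=
  (U <= V)%MS /\
  exists (modU : mxmodule rG U) (modV : mxmodule rG V),
    inhabited (mxsemisimple (section_repr modU modV) 1%:M).

Definition is_radical (V U : 'M[F]_n) : Prop :=
  semisimple_quotient V U /\
  forall W : 'M[F]_n, semisimple_quotient V W -> (U <= W)%MS.

End Radical.

Notation point F := {p : {vspace 'rV[F]_4} | \dim p == 1%N}.

Section ProjectiveSpace.

Variable F : finFieldType.

Definition GL_lin (g : {'GL_4[F]}) : 'End('rV[F]_4) :=
  linfun (mulmxr (GLval g)).

Lemma GL_linE g v : GL_lin g v = v *m GLval g.
Proof. exact: lfunE. Qed.

Lemma GL_lin_ker g : lker (GL_lin g) == 0%VS.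
Proof.
apply/lker0P=> u v; rewrite !GL_linE.
by apply: (can_inj (mulmxK (GL_unitmx g))).
Qed.

Fact point_act_subproof (p : point F) (g : {'GL_4[F]}) :
  \dim (GL_lin g @: val p) == 1%N.
Proof.
by rewrite limg_dim_eq ?(valP p) // (eqP (GL_lin_ker g)) capv0.
Qed.

Definition point_act (p : point F) (g : {'GL_4[F]}) : point F :=
  Sub (GL_lin g @: val p)%VS (point_act_subproof p g).

Fact point_act_is_action : is_action [set: {'GL_4[F]}] point_act.
Proof.
apply: is_total_action => [p | p g h]; apply: val_inj => /=.
  rewrite -[RHS]lim1g; apply: eq_in_limg => v _.
  by rewrite GL_linE id_lfunE GL_1E mulmx1.
rewrite -limg_comp; apply: eq_in_limg => v _.
by rewrite comp_lfunE !GL_linE GL_ME mulmxA.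
Qed.
Canonical point_action := Action point_act_is_action.

(* PGL(4,q) is 'GL_4[F] / 'Z('GL_4[F]).  The quotient action to %% A is only
   the one induced by to at points fixed by A, which is every point here. *)
Definition PGL_action := (point_action %% 'Z('GL_4[F]))%act.

Fact center_GL_scalar (z : {'GL_4[F]}) :
  z \in 'Z('GL_4[F])%g -> exists a, GLval z = a%:M.
Proof.
case/centerP=> _ cz; have zE i j : i != j ->
    GLval z *m delta_mx i j = delta_mx i j *m GLval z.
  move=> ne_ij; have tU : (1 + delta_mx i j : 'M[F]_4) \is a GRing.unit.
    apply/unitrP; exists (1 - delta_mx i j).
    have d2 : delta_mx i j * delta_mx i j = 0 :> 'M[F]_4.
      by rewrite -mulmxE mul_delta_mx_cond eq_sym (negPf ne_ij).
    rewrite !(mulrDl, mulrDr, mulNr, mulrN) !mul1r !mulr1 d2.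
    by rewrite !(subr0, oppr0, addr0) !addrK ?subrK.
  have /(congr1 (@GLval _ _)) := cz (Sub (1 + delta_mx i j) tU) (in_setT _).
  rewrite !GL_ME SubK -!mulmxE mulmxDl mulmxDr mulmx1 mul1mx.
  exact: addrI.
have zEE (k i j : 'I_4) : i != j -> GLval z k i = (GLval z j j) *+ (k == i).
  move/zE/matrixP/(_ k j); rewrite !mxE (bigD1 i) //= big1 => [|l /negPf nl].
    rewrite mxE !eqxx mulr1 addr0 (bigD1 j) //= big1 => [|l /negPf nl].
      by rewrite mxE !eqxx andbT addr0 mulr_natl.
    by rewrite mxE nl andbF mul0r.
  by rewrite mxE nl mulr0.
exists (GLval z ord0 ord0); apply/matrixP=> k i; rewrite !mxE.
have [->|ne_i0] := eqVneq i ord0; last exact: zEE.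
have [->|ne_k0] := eqVneq k ord0; first by [].
by rewrite (zEE k ord0 ord_max) // (negPf ne_k0).
Qed.

Lemma PGL_actionE (p : point F) (g : {'GL_4[F]}) :
  PGL_action p (coset 'Z('GL_4[F]) g) = point_act p g.
Proof.
apply: modactE; first exact: in_setT.
  exact: subsetP (normal_norm (center_normal 'GL_4[F])) g (in_setT g).
apply/afixP=> z /setIP[_ /center_GL_scalar[a za]]; apply: val_inj => /=.
apply/eqP; rewrite eqEdim (eqP (valP p)) (eqP (point_act_subproof p z)) andbT.
apply/subvP=> _ /memv_imgP[v pv ->].
by rewrite GL_linE za mul_mx_scalar memvZ.
Qed.

End ProjectiveSpace.

Section SymplecticQuadrangle.

Variables (F : finFieldType) (f : {skew_symmetric 'rV[F]_4}).

Definition Sp : {set {'GL_4[F]}} :=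
  [set g : {'GL_4[F]} | [forall u : 'rV[F]_4, forall v : 'rV[F]_4,
                           f (GL_lin g u) (GL_lin g v) == f u v]].

Fact Sp_group_set : group_set Sp.
Proof.
apply/group_setP; split=> [|g h].
  by rewrite inE; apply/'forall_forallP => u v; rewrite !GL_linE GL_1E !mulmx1.
rewrite !inE => /'forall_forallP fg /'forall_forallP fh.
apply/'forall_forallP => u v; rewrite -(eqP (fg u v)).
by rewrite -(eqP (fh (GL_lin g u) (GL_lin g v))) !GL_linE GL_ME !mulmxA.
Qed.
Canonical Sp_group := Group Sp_group_set.

(* The image of Sp(4,q) in PGL(4,q). *)
Definition PSp : {group coset_of 'Z('GL_4[F])} := (Sp_group / 'Z('GL_4[F]))%G.

Fact PSp_sub : PSp \subset ([set: {'GL_4[F]}] / 'Z('GL_4[F]))%g.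
Proof. by apply: quotientS; apply: subsetT. Qed.

Definition point_module := permod_repr 'F_2 (@PGL_action F) PSp_sub.

Definition points_of (m : {vspace 'rV[F]_4}) : {set point F} :=
  [set p : point F | (val p <= m)%VS].

Definition Wline (m : {vspace 'rV[F]_4}) : bool :=
  (\dim m == 2%N) && (m <= orthov f m)%VS.

Definition dual_grids : {set {set point F}} :=
  [set points_of m :|: points_of (orthov f m)
    | m : {vspace 'rV[F]_4} & (\dim m == 2%N) && ~~ Wline m].

Definition dual_grid_module : 'M['F_2]_#|{: point F}| :=
  (\sum_(S in dual_grids) cyclic_mx point_module (charv 'F_2 S))%MS.

End SymplecticQuadrangle.

(* Main.v *)
Require Import Defs.
From mathcomp Require Import all_boot all_fingroup all_algebra.
From mathcomp Require Import all_solvable mxrepresentation finfield ring.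

Set Implicit Arguments.
Unset Strict Implicit.
Unset Printing Implicit Defensive.

Import GRing.Theory.
Local Open Scope ring_scope.

(** Let [q] be the order of [F], [D] the module of dual grids and [U] the span
    of the sums of two dual grids.  All three claims follow from one fact,
    [proper_submodule_relation]: if a submodule [W] that does not contain [D]
    contains a combination [\sum_d x_d d] of dual grids, then
    [\sum_d x_d = 0].  For [W = 0] it says that a single dual grid is not in
    [U], so [U] has codimension one in [D].  For general [W] it says that
    [D <= W + U] forces [D <= W], as in Nakayama's lemma.  If [D / W] is
    semisimple, a complement of [(W + U) / W] therefore is everything, and so
    [U <= W]: hence [U] is the radical.

    To prove the fact, take a linear functional that vanishes on [W] but not on
    [D].  It is a function [h] on the points whose sum over some dual grid [d0]
    is not zero; write [v d] for its sum over [d].  As [W] is a submodule,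
    [\sum_d x_d v (d g) = 0] for all [g] in [Sp].  The functions of [d] that
    satisfy these equations in place of [v] form a space over [F] which is
    stable under [Sp], and it suffices to find the constant 1 in it
    ([coefficient_sum_eq0]).  With respect to a symplectic basis adapted to
    [d0], a dual grid [d] is given by a symplectic matrix [M]: the first two and
    the last two rows span its two lines, and the 2 x 2 minors of the first two
    rows are coordinates of the first line.

    - The stabilizer of [d0] contains a torus of odd order [(q + 1) ^ 2].
      Averaging over it keeps the value at [d0] and turns [h] into a function
      of the ratio of two anisotropic binary quadratic forms.  The parity of
      the number of zeros of a binary form [A s^2 + B s t + C t^2] only depends
      on whether [B = 0]; hence the sum of such an [h] over a line only depends
      on the polar forms ([sum_pair_binary_forms]), and [v] has become
      [G b], where [b] is the first minor, [G (b + 1) = G b] and [G 1 != 0]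
      ([sum_torus_grid_sum]).

    - By its periodicity, [G] is a polynomial of degree [j < q - 1].  A
      one-parameter group of symplectic matrices changes [b] to [b + t z], with
      [z] another minor, and a weighted sum over [t] extracts [z ^ j].  A second
      one changes [z] to [z + c + z' c ^ 2]; a weighted sum over [c] extracts
      the middle coefficient of [(z + c + z' c ^ 2) ^ j], which is 1 because the
      central binomial coefficients are even.

    The scalars of the weights lie in [F] rather than in the prime field, so the
    equations are transported to [F]; the conclusion [\sum_d x_d = 0] descends. *)

Local Notation o0 := (@Ordinal 4 0 isT).
Local Notation o1 := (@Ordinal 4 1 isT).
Local Notation o2 := (@Ordinal 4 2 isT).
Local Notation o3 := (@Ordinal 4 3 isT).

(** * Sums over a finite field of characteristic two *)

Section Characteristic2.

Variable k : finFieldType.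
Hypothesis char2 : 2 \in [pchar k].

(** The two elements of an orbit are told apart by their ranks in the
    enumeration, so that the sum splits into two equal halves. *)
Lemma sum_free_involution (T : finType) (s : T -> T) (phi : T -> k) :
  involutive s -> (forall t, s t != t) -> (forall t, phi (s t) = phi t) ->
  \sum_t phi t = 0.
Proof.
move=> sK s_free phi_s.
rewrite (bigID (fun t => (enum_rank t < enum_rank (s t))%N)) /=.
rewrite [X in _ + X](reindex_inj (inv_inj sK)) /=.
rewrite [X in _ + X](eq_bigl (fun t => (enum_rank t < enum_rank (s t))%N)).
  rewrite [X in _ + X](eq_bigr phi) => [|t _]; last exact: phi_s.
  by rewrite addrr_pchar2.
move=> t; rewrite sK -leqNgt ltn_neqAle.
by rewrite (inj_eq val_inj) (inj_eq enum_rank_inj) eq_sym s_free.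
Qed.

Lemma sum_periodic (u : k) (phi : k -> k) :
  u != 0 -> (forall t, phi (t + u) = phi t) -> \sum_t phi t = 0.
Proof.
move=> u0 phi_u; apply: (@sum_free_involution _ (fun t => t + u)) => // t.
  by rewrite -addrA addrr_pchar2 // addr0.
by rewrite -subr_eq0 addrC addKr.
Qed.

Lemma card_char2 : #|k|%:R = 0 :> k.
Proof.
rewrite -sum1_card natr_sum; apply: (@sum_periodic 1) => //; exact: oner_neq0.
Qed.

Lemma card_predK : #|k|.-1.+1 = #|k|.
Proof. by rewrite prednK // (ltnW (finNzRing_gt1 k)). Qed.

Lemma card_pred_gt0 : (0 < #|k|.-1)%N.
Proof. by rewrite -ltnS card_predK finNzRing_gt1. Qed.

Lemma card_pred_char2 : #|k|.-1%:R = 1 :> k.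
Proof.
have /eqP := card_char2; rewrite -card_predK -natr1 addr_eq0.
by move/eqP->; rewrite oppr_pchar2.
Qed.

Lemma expf_card_pred (c : k) : c != 0 -> c ^+ #|k|.-1 = 1.
Proof.
by move=> c0; apply: (mulfI c0); rewrite -exprS card_predK expf_card mulr1.
Qed.

Lemma sum_expr_card_pred : \sum_(c : k) c ^+ #|k|.-1 = 1.
Proof.
rewrite (bigD1 0) //= expr0n eqn0Ngt card_pred_gt0 add0r.
rewrite (eq_bigr (fun=> 1)) => [|c /expf_card_pred //].
by rewrite sumr_const cardC1 card_pred_char2.
Qed.

(** If [a ^+ N != 1], replacing [c] by [a * c] multiplies the sum by [a ^+ N];
    such a nonzero [a] exists, as ['X^N - 1] has at most [N] roots. *)
Lemma sum_expr_small N : (N < #|k|.-1)%N -> \sum_(c : k) c ^+ N = 0.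
Proof.
case: N => [_|N ltN]; first by rewrite sumr_const card_char2.
have [a a0 aN] : exists2 a : k, a != 0 & a ^+ N.+1 != 1.
  apply/exists_inP; apply: contraLR ltN => /exists_inPn unityN; rewrite -leqNgt.
  have -> : #|k|.-1 = size (enum (predC1 (0 : k))) by rewrite -cardE cardC1.
  apply: max_unity_roots; rewrite ?enum_uniq //.
  apply/allP=> a; rewrite mem_enum => a0; rewrite unity_rootE.
  by have := unityN a a0; rewrite negbK.
apply/eqP; have := subrr (\sum_(c : k) c ^+ N.+1).
rewrite {1}(reindex_inj (mulfI a0)) /=.
under eq_bigr do rewrite exprMn.
rewrite -mulr_sumr -[X in _ - X]mul1r -mulrBl => /eqP.
by rewrite mulf_eq0 subr_eq0 (negPf aN).
Qed.

(** Weighting by [c ^+ (q - 1 - j)] moves the coefficient of degree [j] to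
    degree [q - 1], the only one whose power sum survives. *)
Lemma sum_horner_weighted (P : {poly k}) j :
    (0 < j < #|k|.-1)%N -> (size P <= #|k|.-1 + j)%N ->
  \sum_(c : k) c ^+ (#|k|.-1 - j) * P.[c] = P`_j.
Proof.
case/andP=> j_gt0 ltj leP; have le_j : (j < #|k|.-1 + j)%N.
  by rewrite -[X in (X < _)%N]add0n ltn_add2r card_pred_gt0.
under eq_bigr => c _ do rewrite (horner_coef_wide c leP) mulr_sumr.
rewrite exchange_big /= (bigD1 (Ordinal le_j)) //= [X in _ + X]big1 ?addr0 => [|i].
  under eq_bigr => c _ do rewrite mulrCA -exprD subnK ?(ltnW ltj) //.
  by rewrite -mulr_sumr sum_expr_card_pred mulr1.
rewrite -val_eqE /= => ne_ij.
under eq_bigr => c _ do rewrite mulrCA -exprD.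
rewrite -mulr_sumr; have [lt_ij|] := ltnP i j.
  rewrite sum_expr_small ?mulr0 // addnC addnBA ?(ltnW ltj) //.
  by rewrite ltn_subLR ?ltn_add2r ?(leq_trans (ltnW ltj)) ?leq_addl.
rewrite leq_eqVlt eq_sym (negPf ne_ij) /= => lt_ji.
under eq_bigr => c _.
  have -> : (#|k|.-1 - j + i = #|k|.-1 + (i - j))%N.
    by rewrite addnBAC ?(ltnW ltj) // addnBA // ltnW.
  have -> : c ^+ (#|k|.-1 + (i - j)) = c ^+ (i - j).
    have [->|c0] := eqVneq c 0; last by rewrite exprD expf_card_pred ?mul1r.
    by rewrite !expr0n addn_eq0 subn_eq0 leqNgt lt_ji andbF.
  over.
rewrite sum_expr_small ?mulr0 // ltn_subLR ?(ltnW lt_ji) //.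
by rewrite [ltnRHS]addnC; apply: ltn_ord.
Qed.

Lemma coef_linear_exp (b z : k) j i :
  (j <= i)%N -> ((b%:P + z *: 'X) ^+ j)`_i = (z ^+ j) *+ (i == j).
Proof.
elim: j i => [|j IHj] i; first by rewrite !expr0 coef1.
case: i => // i lt_ji.
rewrite exprS mulrDl coefD coefCM -scalerAl coefZ coefXM /= !IHj //; last first.
  exact: leqW.
by rewrite (gtn_eqF lt_ji) mulr0n mulr0 add0r eqSS exprS mulrnAr.
Qed.

(** The interpolation polynomial of [G] has degree at most [q - 1], with
    coefficient [- \sum_a G a] in degree [q - 1]; periodicity kills this sum. *)
Lemma periodic_polynomial (G : k -> k) : (forall b, G (b + 1) = G b) ->
  exists2 P : {poly k}, (size P <= #|k|.-1)%N & forall b, P.[b] = G b.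
Proof.
move=> G_per; pose e a : {poly k} := ((- a)%:P + 1 *: 'X) ^+ #|k|.-1.
pose P := \sum_a G a *: (1 - e a).
exists P => [|b].
  apply/leq_sizeP => i le_i; rewrite coef_sum.
  have eE a : (e a)`_i = (i == #|k|.-1)%:R by rewrite coef_linear_exp // expr1n.
  under eq_bigr => a _ do rewrite coefZ coefB eE.
  rewrite coef1 eqn0Ngt (leq_trans card_pred_gt0 le_i) sub0r.
  by rewrite -mulr_suml (sum_periodic (oner_neq0 k)) ?mul0r.
have eE a : (1 - e a).[b] = 1 - (b - a) ^+ #|k|.-1.
  by rewrite /e !hornerE [- a + b]addrC.
rewrite horner_sum (bigD1 b) //= big1 ?addr0 => [|a ne_ab]; rewrite hornerZ eE.
  by rewrite subrr expr0n eqn0Ngt card_pred_gt0 subr0 mulr1.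
by rewrite expf_card_pred ?subrr ?mulr0 // subr_eq0 eq_sym.
Qed.

Lemma bin_double_even l : (0 < l)%N -> ('C(l.*2, l))%:R = 0 :> k.
Proof.
case: l => // l _; rewrite doubleS binS.
have -> : 'C(l.*2.+1, l.+1) = 'C(l.*2.+1, l).
  have le_l : (l <= l.*2.+1)%N by rewrite -addnn -addSn leq_addl.
  by rewrite -(bin_sub le_l) -addnn -addSn addnK.
by rewrite natrD addrr_pchar2.
Qed.

(** Only the term with [z'] to the power [i / 2] has degree [i], and its
    coefficient is a central binomial coefficient. *)
Lemma coef_even_exp (z z' : k) i :
  ((z%:P + z' *: 'X^2) ^+ i)`_i = (i == 0)%:R.
Proof.
rewrite exprDn coef_sum (eq_bigr (fun l : 'I_i.+1 =>
  z ^+ (i - l) * z' ^+ l *+ ('C(i, l) * (i == l.*2)))) => [|l _]; last first.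
  rewrite coefMn -rmorphXn coefCM exprZn coefZ -exprM coefXn mul2n.
  by rewrite mulrA mulr_natr mulnC mulrnA.
have [->|i0] := eqVneq i 0%N; first by rewrite big_ord_recl big_ord0 addr0 !mulr1.
rewrite big1 // => l _; case: eqP => [il|_]; last by rewrite muln0 mulr0n.
rewrite muln1 -mulr_natr [X in 'C(X, _)]il bin_double_even ?mulr0 //.
by rewrite lt0n; apply: contra_neq i0 => l0; rewrite il l0.
Qed.

Lemma coef_central_exp (z z' : k) j :
  ((z%:P + 'X + z' *: 'X^2) ^+ j)`_j = 1.
Proof.
rewrite (addrC z%:P) -addrA exprDn coef_sum big_ord_recl /= big1 => [|i _].
  by rewrite bin0 subn0 expr0 mulr1 mulr1n coefXn eqxx addr0.
rewrite coefMn coefXnM ltnNge leq_subr /= subKn ?(ltnW (ltn_ord _)) //.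
by rewrite coef_even_exp mul0rn.
Qed.

Lemma sqrt_char2 (a : k) : exists b, a = b ^+ 2.
Proof.
have odd_q : odd #|k| = false.
  apply/negbTE/negP => oddq; have /eqP := card_char2.
  by rewrite -[#|k|]odd_double_half oddq -muln2 natrD natrM (pcharf0 char2)
    mulr0 addr0 oner_eq0.
exists (a ^+ #|k|./2); rewrite -exprM muln2.
by rewrite -[in LHS](expf_card a) -[in LHS](odd_double_half #|k|) odd_q.
Qed.

(** * Values of binary quadratic forms *)

(** If [B = 0] the form is the square of a linear form, whose zeros form a
    subspace of even order.  Otherwise, if [C != 0], the zeros with [s != 0] are
    paired by the translation [t -> t + B s / C], and if [C = 0] the form is a
    product of two independent linear forms.  Zero itself is not counted. *)
Lemma count_binary_form_zeros (A B C : k) :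
  \sum_(z : k * k | z != 0) (A * z.1 ^+ 2 + B * z.1 * z.2 + C * z.2 ^+ 2 == 0)%:R
    = (B == 0)%:R :> k.
Proof.
pose R s t := A * s ^+ 2 + B * s * t + C * t ^+ 2.
suff total : \sum_s \sum_t (R s t == 0)%:R = (B != 0)%:R :> k.
  move: total; rewrite pair_bigA /= (bigD1 (0 : k * k)) //= {1}/R /=.
  rewrite !expr0n !mulr0 !addr0 eqxx => /(canRL (addKr _)) ->.
  by rewrite oppr_pchar2 //; case: eqP; rewrite /= ?addr0 ?addrr_pchar2.
have line (a b : k) : b != 0 -> \sum_t (a + b * t == 0)%:R = 1 :> k.
  move=> b0; rewrite (bigD1 (- a / b)) //= [b * _]mulrC divfK // subrr eqxx.
  rewrite big1 ?addr0 // => t ne_t; rewrite addrC addr_eq0.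
  by case: eqP => // bt; case/eqP: ne_t; rewrite -bt mulrC mulKf.
have card0 : \sum_(s : k) 1 = 0 :> k by rewrite sumr_const card_char2.
have [B0|B0] := eqVneq B 0.
  have [a aA] := sqrt_char2 A; have [c cC] := sqrt_char2 C.
  have RE s t : (R s t == 0) = (a * s + c * t == 0).
    have -> : R s t = (a * s + c * t) ^+ 2.
      rewrite /R B0 aA cC !mul0r addr0 sqrrD !exprMn.
      by rewrite -mulr_natr (pcharf0 char2) mulr0 addr0.
    by rewrite expf_eq0.
  under eq_bigr do under eq_bigr do rewrite RE.
  have [c0|c0] := eqVneq c 0; last first.
    by rewrite (eq_bigr (fun=> 1)) ?card0 // => s _; apply: line.
  rewrite big1 // => s _.
  rewrite (eq_bigr (fun=> (a * s == 0)%:R)) => [|t _]; last by rewrite c0 mul0r addr0.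
  by rewrite sumr_const mulrnAC card_char2 mul0rn.
have [C0|C0] := eqVneq C 0.
  rewrite (bigD1 0) //= [X in X + _](eq_bigr (fun=> 1)) => [|t _]; last first.
    by rewrite /R C0 !(expr0n, mulr0, mul0r, addr0) eqxx.
  rewrite card0 add0r (eq_bigr (fun=> 1)) => [|s s0]; last first.
    rewrite -[RHS](line (A * s ^+ 2) (B * s)) ?mulf_neq0 //.
    by apply: eq_bigr => t _; rewrite /R C0 mul0r addr0.
  by rewrite sumr_const cardC1 card_pred_char2.
rewrite (bigD1 0) //= [X in _ + X]big1 ?addr0 => [|s s0].
  rewrite (bigD1 0) //= big1 /R => [|t t0].
    by rewrite !(expr0n, mulr0, mul0r, addr0) eqxx.
  by rewrite !(expr0n, mulr0, mul0r, add0r) mulf_eq0 expf_eq0 /= (negPf C0) (negPf t0).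
apply: (@sum_periodic (B * s / C)) => [|t]; first by rewrite !mulf_neq0 ?invr_eq0.
congr (_ == _)%:R; rewrite /R.
have -> : A * s ^+ 2 + B * s * (t + B * s / C) + C * (t + B * s / C) ^+ 2
  = (A * s ^+ 2 + B * s * t + C * t ^+ 2)
    + (B * s * (t + B * s / C) + B * s * (t + B * s / C)) by field.
by rewrite addrr_pchar2 // addr0.
Qed.

Section HomogeneousFunction.

Variable K : k -> k -> k.
Hypothesis K_hom : forall c a b, c != 0 -> K (c * a) (c * b) = K a b.

(** The condition says that [w] is proportional to [v]; there are [q - 1] such
    nonzero [w], an odd number, and [K] has the same value at all of them. *)
Lemma sum_proportional (v : k * k) : v != 0 ->
  \sum_(w : k * k | w != 0) K w.1 w.2 * (w.2 * v.1 + w.1 * v.2 == 0)%:R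
    = K v.1 v.2.
Proof.
case: v => v1 v2 /= v0.
rewrite (eq_bigr (fun w => if w.2 * v1 + w.1 * v2 == 0 then K w.1 w.2 else 0));
  last by move=> w _; case: ifP; rewrite (mulr1, mulr0).
rewrite -big_mkcondr /=.
pose coef (w : k * k) := if v1 != 0 then w.1 / v1 else w.2 / v2.
rewrite (reindex_onto (fun c => (c * v1, c * v2)) coef) => [|[w1 w2] /andP[w0] /=].
  rewrite (eq_bigl (predC1 0)) => [|c /=]; last first.
    rewrite mulrAC addrr_pchar2 // eqxx andbT /coef /=.
    have [->|c0] := eqVneq c 0; first by rewrite !mul0r eqxx.
    have -> : ((c * v1, c * v2) != 0) = ((v1, v2) != 0).
      by rewrite -![_ == 0]/((_ == 0) && (_ == 0)) /= !mulf_eq0 (negPf c0).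
    rewrite v0; have [v10|v10] := eqVneq v1 0; rewrite /= mulfK ?eqxx //.
    by apply: contraNneq v0 => v20; rewrite v10 v20.
  rewrite (eq_bigr (fun=> K v1 v2)) => [|c c0 /=]; last exact: K_hom.
  by rewrite sumr_const cardC1 -mulr_natr card_pred_char2 mulr1.
rewrite addr_eq0 oppr_pchar2 // => /eqP w_v; rewrite /coef.
have [v10|v10] := eqVneq v1 0; rewrite /=.
  have v20 : v2 != 0 by apply: contraNneq v0 => v20; rewrite v10 v20.
  move/eqP: w_v; rewrite v10 mulr0 eq_sym mulf_eq0 (negPf v20) orbF => /eqP ->.
  by rewrite mulr0 divfK.
by rewrite divfK // mulrAC -w_v mulfK.
Qed.

(** Write each [K (q1 z) (q2 z)] as a sum over the [w] proportional to
    [(q1 z, q2 z)] and exchange the sums: for fixed [w], the condition on [z] is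
    that a binary quadratic form vanishes, and the parity of the number of its
    zeros is decided by [w.2 * B1 + w.1 * B2]. *)
Lemma sum_pair_binary_forms A1 B1 C1 A2 B2 C2 :
    let q1 z := A1 * z.1 ^+ 2 + B1 * z.1 * z.2 + C1 * z.2 ^+ 2 in
    let q2 z := A2 * z.1 ^+ 2 + B2 * z.1 * z.2 + C2 * z.2 ^+ 2 in
    (forall z : k * k, z != 0 -> (q1 z, q2 z) != 0) -> (B1, B2) != 0 ->
  \sum_(z : k * k | z != 0) K (q1 z) (q2 z) = K B1 B2.
Proof.
move=> q1 q2 q_neq0 B_neq0.
under eq_bigr => z z0 do rewrite -[K _ _](sum_proportional (q_neq0 z z0)).
rewrite exchange_big -[RHS](sum_proportional B_neq0) /=.
apply: eq_bigr => w _; rewrite -mulr_sumr; congr (_ * _).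
rewrite -(count_binary_form_zeros (w.2 * A1 + w.1 * A2) _ (w.2 * C1 + w.1 * C2)).
apply: eq_bigr => z _; congr (_ == _)%:R; rewrite /q1 /q2; ring.
Qed.

End HomogeneousFunction.

(** * The torus of norm-one elements *)

(** The map [x -> x ^+ 2 + x] identifies 0 and 1, so it is not onto. *)
Lemma exists_irreducible_quadratic : exists l : k, forall x, x ^+ 2 + x + l != 0.
Proof.
pose p (x : k) := x ^+ 2 + x.
suff [l /forallP no_root] : exists l, [forall x, p x != l].
  exists l => x; rewrite addr_eq0 oppr_pchar2 //; exact: no_root.
apply/existsP; apply: contraT => /existsPn surj.
have {}surj l : exists x, p x == l.
  by have /forallPn[x] := surj l; rewrite negbK; exists x.
have pK : cancel (fun l => xchoose (surj l)) p.
  by move=> l; apply/eqP; apply: xchooseP (surj l).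
have /eqP := oner_neq0 k; case; apply: (can_inj (canF_sym pK)).
by rewrite /p expr0n expr1n addr0 addrr_pchar2.
Qed.

Section NormOneTorus.

Variable l : k.
Hypothesis l_irr : forall x, x ^+ 2 + x + l != 0.

(** The pair [x] stands for [x.1 + x.2 * alpha] in the quadratic extension of
    [k] by a root of [alpha ^+ 2 = alpha - l]; [qnorm], [qmul] and [qinv] are the
    norm, the product and the inverse of that field. *)
Definition qnorm (x : k * k) := x.1 ^+ 2 + x.1 * x.2 + l * x.2 ^+ 2.
Definition qmul (x y : k * k) :=
  (x.1 * y.1 - l * x.2 * y.2, x.2 * y.1 + x.1 * y.2 + x.2 * y.2).

Lemma qnorm0 : qnorm 0 = 0.
Proof. by rewrite /qnorm /= expr0n /= !mulr0 !addr0. Qed.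

Lemma qmul0 x : qmul x 0 = 0.
Proof. by rewrite /qmul /= !mulr0 subr0 !addr0. Qed.

Lemma qnorm_eq0 x : (qnorm x == 0) = (x == 0).
Proof.
apply/eqP/eqP => [|->]; last exact: qnorm0.
case: x => x y; rewrite /qnorm /= => xy0.
have [y0|y0] := eqVneq y 0.
  move/eqP: xy0; rewrite y0 expr0n /= !mulr0 !addr0 expf_eq0 /=.
  by move/eqP->.
case/eqP: (l_irr (x / y)); apply: (mulIf (expf_neq0 2 y0)).
by rewrite mul0r -[RHS]xy0; field.
Qed.

Lemma qnormZ c x : qnorm (c * x.1, c * x.2) = c ^+ 2 * qnorm x.
Proof. by rewrite /qnorm /=; ring. Qed.

(** The norm-one group has odd order.  For [s != 0] the translation
    [t -> t + s / l] pairs the elements [(s, t)]; for [s = 0] exactly one [t]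
    remains, the square root of [l^-1]. *)
Lemma sum_qnorm_one : \sum_(a | qnorm a == 1) 1 = 1 :> k.
Proof.
have l0 : l != 0 by have := l_irr 0; rewrite expr0n !add0r.
rewrite big_mkcond -(pair_bigA _ (fun s t => if qnorm (s, t) == 1 then 1 else 0)) /=.
rewrite (bigD1 0) //= [X in _ + X]big1 ?addr0 => [|s s0].
  have [b bl] := sqrt_char2 l^-1; rewrite (bigD1 b) //= big1 => [|t ne_t].
    by rewrite /qnorm /= expr0n mul0r !add0r -bl divff ?eqxx ?addr0.
  rewrite /qnorm /= expr0n mul0r !add0r; case: eqP => // t1.
  case/eqP: ne_t; apply/eqP; rewrite -subr_eq0.
  suff /eqP : (t - b) ^+ 2 = 0 by rewrite expf_eq0.
  have -> : (t - b) ^+ 2 = t ^+ 2 + b ^+ 2 - (t * b + t * b) by ring.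
  by rewrite addrr_pchar2 // subr0 -bl -[t ^+ 2](mulKf l0) t1 mulr1 addrr_pchar2.
apply: (@sum_periodic (s / l)) => [|t]; first by rewrite mulf_neq0 ?invr_eq0.
congr (if _ == _ then _ else _); rewrite /qnorm /=.
have -> : s ^+ 2 + s * (t + s / l) + l * (t + s / l) ^+ 2
  = s ^+ 2 + s * t + l * t ^+ 2 + (s * (t + s / l) + s * (t + s / l)) by field.
by rewrite addrr_pchar2 // addr0.
Qed.

Definition qinv (x : k * k) := ((x.1 + x.2) / qnorm x, - x.2 / qnorm x).

Lemma qmulKV x : x != 0 -> cancel (qmul^~ (qinv x)) (qmul^~ x).
Proof.
rewrite -qnorm_eq0 => Nx0 [y1 y2]; rewrite /qmul /qinv /=.
by congr pair; move: Nx0; rewrite /qnorm => Nx0; field.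
Qed.

Lemma qmulK x : x != 0 -> cancel (qmul^~ x) (qmul^~ (qinv x)).
Proof.
rewrite -qnorm_eq0 => Nx0 [y1 y2]; rewrite /qmul /qinv /=.
by congr pair; move: Nx0; rewrite /qnorm => Nx0; field.
Qed.

Lemma qmulC x y : qmul x y = qmul y x.
Proof. by congr pair; ring. Qed.

Lemma qnormM x y : qnorm (qmul x y) = qnorm x * qnorm y.
Proof. by rewrite /qnorm /qmul /=; ring. Qed.

(** The norm-one group acts regularly on the nonzero vectors of a given norm,
    and it fixes 0; the formula holds at 0 because the group has odd order. *)
Lemma sum_torus_orbit (phi : k * k -> k) x :
  \sum_(a | qnorm a == 1) phi (qmul a x) = \sum_(y | qnorm y == qnorm x) phi y.
Proof.
have [->|x0] := eqVneq x 0.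
  under eq_bigr do rewrite qmul0.
  have -> : \sum_(y | qnorm y == qnorm 0) phi y = phi 0.
    by apply: big_pred1 => y; rewrite qnorm0 qnorm_eq0.
  rewrite -[RHS]mul1r -[X in _ = X * _]sum_qnorm_one mulr_suml.
  by apply: eq_bigr => a _; rewrite mul1r.
rewrite [RHS](reindex_onto (qmul^~ x) (qmul^~ (qinv x))) => [|y _]; last first.
  exact: qmulKV.
apply: eq_bigl => a; rewrite qmulK // eqxx andbT qnormM.
have Nx0 : qnorm x != 0 by rewrite qnorm_eq0.
by rewrite -[X in _ = (_ == X)]mul1r (inj_eq (mulIf Nx0)).
Qed.

(** * Symplectic matrices *)

(** Vectors of length 4 are split into their components in the two hyperbolic
    planes of the standard alternating form [symp_mx]. *)
Definition vec4 (x y : k * k) : 'rV[k]_4 := \row_j [:: x.1; x.2; y.1; y.2]`_j.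
Definition mx4 (r0 r1 r2 r3 : 'rV[k]_4) : 'M[k]_4 :=
  \matrix_(i < 4) [:: r0; r1; r2; r3]`_i.
Definition symp_mx := mx4 (vec4 (0, 1) 0) (vec4 (- 1, 0) 0) (vec4 0 (0, 1)) (vec4 0 (- 1, 0)).
Definition symplectic (M : 'M[k]_4) := M *m symp_mx *m M^T = symp_mx.

Lemma ord4_ind (P : 'I_4 -> Prop) : P o0 -> P o1 -> P o2 -> P o3 -> forall i, P i.
Proof.
move=> P0 P1 P2 P3 [i lti]; rewrite (_ : Ordinal lti = inord i); last first.
  by apply: val_inj; rewrite /= inordK.
case: i lti => [|[|[|[|//]]]] _; [move: P0|move: P1|move: P2|move: P3];
  by congr P; apply: val_inj; rewrite /= inordK.
Qed.

Lemma sum_ord4 (V : nmodType) (E : 'I_4 -> V) :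
  \sum_i E i = E o0 + E o1
             + E o2 + E (@Ordinal 4 3 isT).
Proof.
rewrite !big_ord_recl big_ord0 addr0 !addrA.
by do ![congr (_ + _)]; congr E; apply: val_inj.
Qed.

Lemma vec4M x y (M : 'M[k]_4) : vec4 x y *m M =
  vec4 (x.1 * M o0 o0 + x.2 * M o1 o0 + y.1 * M o2 o0 + y.2 * M o3 o0,
      x.1 * M o0 o1 + x.2 * M o1 o1 + y.1 * M o2 o1 + y.2 * M o3 o1)
     (x.1 * M o0 o2 + x.2 * M o1 o2 + y.1 * M o2 o2 + y.2 * M o3 o2,
      x.1 * M o0 o3 + x.2 * M o1 o3 + y.1 * M o2 o3 + y.2 * M o3 o3).
Proof.
by apply/rowP; elim/ord4_ind; rewrite !mxE sum_ord4 !mxE.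
Qed.

Lemma vec4_scale c x y : c *: vec4 x y = vec4 (c * x.1, c * x.2) (c * y.1, c * y.2).
Proof. by apply/rowP; elim/ord4_ind; rewrite !mxE. Qed.

Lemma symplectic_mulE (M : 'M[k]_4) i j : (M *m symp_mx *m M^T) i j =
  M i o0 * M j o1
  - M i o1 * M j o0
  + M i o2 * M j o3
  - M i o3 * M j (@Ordinal 4 2 isT).
Proof. rewrite !mxE !sum_ord4 !mxE !sum_ord4 !mxE /=; ring. Qed.

Lemma symplecticM M N : symplectic M -> symplectic N -> symplectic (M *m N).
Proof.
rewrite /symplectic => sM sN.
by rewrite trmx_mul !mulmxA -(mulmxA M) -(mulmxA M) sN.
Qed.

Lemma symp_mx_sqr : symp_mx *m symp_mx = - 1%:M.
Proof.
by apply/matrixP; elim/ord4_ind; elim/ord4_ind; rewrite !mxE sum_ord4 !mxE /=; ring.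
Qed.

Lemma symplectic_unit M : symplectic M -> M \in unitmx.
Proof.
move=> sM; have : M *m (symp_mx *m M^T *m - symp_mx) = 1%:M.
  by rewrite !mulmxA sM mulmxN symp_mx_sqr opprK.
by case/mulmx1_unit.
Qed.

Lemma symplectic_tr M : symplectic M -> symplectic M^T.
Proof.
rewrite /symplectic trmxK => sM; have : M *m (symp_mx *m M^T *m - symp_mx) = 1%:M.
  by rewrite !mulmxA sM mulmxN symp_mx_sqr opprK.
move/mulmx1C => /(congr1 (mulmx symp_mx)); rewrite mulmx1 => {2}<-.
by rewrite !mulmxA symp_mx_sqr mulNmx mul1mx mulmxN !mulNmx opprK.
Qed.

(** The minors of rows [i1], [i2] are the Pluecker coordinates of their span. *)
Definition minor (M : 'M[k]_4) (i1 i2 j1 j2 : 'I_4) := M i1 j1 * M i2 j2 - M i1 j2 * M i2 j1.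

(** Relations 0, 1 and 2, 3 between the rows, and relation 0, 1 between the
    columns: the transpose of a symplectic matrix is symplectic. *)
Lemma symplectic_minors M : symplectic M ->
  [/\ minor M o0 o1 o2 o3 = 1 - minor M o0 o1 o0 o1,
      minor M o2 o3 o0 o1 = 1 - minor M o0 o1 o0 o1
    & minor M o2 o3 o2 o3 = minor M o0 o1 o0 o1].
Proof.
move=> sM; have sMt := symplectic_tr sM.
have sE i j : (M *m symp_mx *m M^T) i j = symp_mx i j by rewrite sM.
have tE i j : (M^T *m symp_mx *m M^T^T) i j = symp_mx i j by rewrite sMt.
move: (sE o0 o1) (sE o2 o3) (tE o0 o1); rewrite !symplectic_mulE !mxE /= => e1 e2 e3.
have e1' : minor M o0 o1 o2 o3 = 1 - minor M o0 o1 o0 o1.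
  by rewrite -{1}e1 /minor; ring.
have e3' : minor M o2 o3 o0 o1 = 1 - minor M o0 o1 o0 o1.
  by rewrite -{1}e3 /minor; ring.
split=> //; transitivity (1 - minor M o2 o3 o0 o1); last by rewrite e3' opprB addrC subrK.
by rewrite -{1}e2 /minor; ring.
Qed.

(** Two one-parameter groups of symplectic matrices, chosen for their effect on
    minors of the first two rows. *)
Definition shear_mx (t : k) :=
  mx4 (vec4 (1, 0) 0) (vec4 (0, 1) (0, - t)) (vec4 (t, 0) (1, 0)) (vec4 0 (0, 1)).
Definition slide_mx (c : k) :=
  mx4 (vec4 (1, 0) (c, 0)) (vec4 (0, 1) 0) (vec4 0 (1, 0)) (vec4 (0, - c) (0, 1)).

Lemma shear_symplectic t : symplectic (shear_mx t).
Proof.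
by apply/matrixP; elim/ord4_ind; elim/ord4_ind; rewrite symplectic_mulE !mxE /=; ring.
Qed.

Lemma slide_symplectic c : symplectic (slide_mx c).
Proof.
by apply/matrixP; elim/ord4_ind; elim/ord4_ind; rewrite symplectic_mulE !mxE /=; ring.
Qed.

Lemma minor_shear N t :
  minor (N *m shear_mx t) o0 o1 o0 o1
    = minor N o0 o1 o0 o1 + t * minor N o0 o1 o2 o1.
Proof. by rewrite /minor !mxE !sum_ord4 !mxE /=; ring. Qed.

(** The linear coefficient is the sum of two minors which is the value of the
    alternating form at the first two rows, that is 1. *)
Lemma minor_slide N c : symplectic N ->
  minor (N *m slide_mx c) o0 o1 o2 o1
    = minor N o0 o1 o2 o1 + c + minor N o0 o1 o0 o3 * c ^+ 2.
Proof.
move=> sN; have [m03 _ _] := symplectic_minors sN.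
rewrite -[X in _ + X + _](mulr1 c) -[X in c * X](subrK (minor N o0 o1 o0 o1)) -m03.
rewrite -[LHS]addr0 -[X in _ + X](addrr_pchar2 char2
  (c * minor N o0 o1 o2 o3 + minor N o0 o1 o0 o3 * c ^+ 2)).
by rewrite /minor !mxE !sum_ord4 !mxE /=; ring.
Qed.

(** * Averages over the torus *)

Section TorusAverage.

Variable h : 'rV[k]_4 -> k.
Hypothesis h_hom : forall (c : k) (v : 'rV[k]_4), c != 0 -> h (c *: v) = h v.

(** The dual grid of the first two and the last two rows of [M]: each point of
    a line occurs [q - 1] times as a nonzero vector, an odd number of times. *)
Definition grid_sum (M : 'M[k]_4) :=
  \sum_(z : k * k | z != 0) (h (vec4 z 0 *m M) + h (vec4 0 z *m M)).

Definition torus_mx (a b : k * k) :=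
  mx4 (vec4 (qmul a (1, 0)) 0) (vec4 (qmul a (0, 1)) 0)
      (vec4 0 (qmul b (1, 0))) (vec4 0 (qmul b (0, 1))).

Lemma vec4_torus x y a b : vec4 x y *m torus_mx a b = vec4 (qmul a x) (qmul b y).
Proof. by rewrite vec4M !mxE /qmul /=; congr (vec4 (_, _) (_, _)); ring. Qed.

Lemma torus_symplectic a b :
  qnorm a == 1 -> qnorm b == 1 -> symplectic (torus_mx a b).
Proof.
move=> /eqP a1 /eqP b1; apply/matrixP; elim/ord4_ind; elim/ord4_ind;
  rewrite symplectic_mulE !mxE /qmul /=;
  first [ring | rewrite -[in RHS]a1 /qnorm; ring | rewrite -[in RHS]b1 /qnorm; ring].
Qed.

Definition orbit_sum (al be : k) :=
  \sum_(y | qnorm y == al) \sum_(y' | qnorm y' == be) h (vec4 y y').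

Lemma sum_torus x y :
  \sum_(a | qnorm a == 1) \sum_(b | qnorm b == 1) h (vec4 x y *m torus_mx a b)
    = orbit_sum (qnorm x) (qnorm y).
Proof.
under eq_bigr do under eq_bigr do rewrite vec4_torus.
under eq_bigr => a _ do rewrite (sum_torus_orbit (fun w => h (vec4 (qmul a x) w))).
exact: (sum_torus_orbit (fun w => \sum_(y' | _) h (vec4 w y'))).
Qed.

(** [c] is the square of some [d], and scaling a vector by [d] multiplies its
    norm by [c]. *)
Lemma orbit_sum_hom c al be :
  c != 0 -> orbit_sum (c * al) (c * be) = orbit_sum al be.
Proof.
have [d ->] := sqrt_char2 c; rewrite expf_eq0 /= => d0.
have scale_bij (E : k * k -> k) a : \sum_(y | qnorm y == d ^+ 2 * a) E y
    = \sum_(y | qnorm y == a) E (d * y.1, d * y.2).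
  rewrite (reindex_onto (fun y => (d * y.1, d * y.2)) (fun y => (d^-1 * y.1, d^-1 * y.2))).
    apply: eq_bigl => -[y1 y2] /=; rewrite !mulKf // eqxx andbT (qnormZ d (y1, y2)).
    by rewrite (inj_eq (mulfI (expf_neq0 2 d0))).
  by case=> y1 y2 _ /=; rewrite !mulVKf.
rewrite /orbit_sum scale_bij; apply: eq_bigr => y _; rewrite scale_bij.
by apply: eq_bigr => y' _; rewrite -vec4_scale h_hom.
Qed.

(** Along the span of two rows, the two norms are binary quadratic forms whose
    polar forms, evaluated at the two rows, are the two minors. *)
Lemma sum_plane_orbit_sum (M : 'M[k]_4) i1 i2 :
    (forall z : k * k, z != 0 -> z.1 *: row i1 M + z.2 *: row i2 M != 0) ->
    (minor M i1 i2 o0 o1, minor M i1 i2 o2 o3) != 0 ->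
  \sum_(z : k * k | z != 0)
     orbit_sum (qnorm (z.1 * M i1 o0 + z.2 * M i2 o0, z.1 * M i1 o1 + z.2 * M i2 o1))
               (qnorm (z.1 * M i1 o2 + z.2 * M i2 o2, z.1 * M i1 o3 + z.2 * M i2 o3))
   = orbit_sum (minor M i1 i2 o0 o1) (minor M i1 i2 o2 o3).
Proof.
move=> row_free minor0.
have qnorm_line x1 x2 y1 y2 (z : k * k) :
    qnorm (z.1 * x1 + z.2 * y1, z.1 * x2 + z.2 * y2)
      = qnorm (x1, x2) * z.1 ^+ 2 + (x1 * y2 - x2 * y1) * z.1 * z.2
        + qnorm (y1, y2) * z.2 ^+ 2.
  rewrite -[RHS]addr0 -[X in _ = _ + X](addrr_pchar2 char2
    (z.1 * z.2 * (x1 * y1 + x2 * y1 + l * x2 * y2))).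
  by rewrite /qnorm /=; ring.
rewrite -(@sum_pair_binary_forms _ orbit_sum_hom
   (qnorm (M i1 o0, M i1 o1)) _ (qnorm (M i2 o0, M i2 o1))
   (qnorm (M i1 o2, M i1 o3)) _ (qnorm (M i2 o2, M i2 o3)) _ minor0).
  by apply: eq_bigr => z _; rewrite !qnorm_line.
move=> z z0; apply: contraNneq (row_free z z0); rewrite -!qnorm_line => -[/eqP].
rewrite qnorm_eq0 => /eqP[e0 e1] /eqP; rewrite qnorm_eq0 => /eqP[e2 e3].
by apply/eqP/rowP; elim/ord4_ind; rewrite !mxE.
Qed.

Lemma sum_torus_grid_sum M : symplectic M ->
  let b := minor M o0 o1 o0 o1 in
  \sum_(a1 | qnorm a1 == 1) \sum_(a2 | qnorm a2 == 1) grid_sum (M *m torus_mx a1 a2)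
    = orbit_sum b (1 - b) + orbit_sum (1 - b) b.
Proof.
move=> sM b; have [m03 m20 m23] := symplectic_minors sM.
have row_free i1 i2 (z : k * k) : i1 != i2 -> z != 0 ->
    z.1 *: row i1 M + z.2 *: row i2 M != 0.
  move=> ne_i; apply: contraNneq; rewrite !rowE !scalemxAl -mulmxDl.
  move/(congr1 (mulmx^~ (invmx M))); rewrite mulmxK ?symplectic_unit // mul0mx.
  move/rowP=> e; case: z e => z1 z2 e; apply/eqP; congr pair.
    by have := e i1; rewrite !mxE !eqxx (negPf ne_i) mulr1 mulr0 addr0.
  by have := e i2; rewrite !mxE !eqxx eq_sym (negPf ne_i) mulr1 mulr0 add0r.
have pair0 (c : k) : (c, 1 - c) != 0 /\ (1 - c, c) != 0.
  split; apply/eqP => -[]; first by move=> -> /eqP; rewrite subr0 oner_eq0.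
  by move=> /eqP; rewrite subr_eq0 => /eqP <- /eqP; rewrite oner_eq0.
have [p1 p2] := pair0 b.
have := @sum_plane_orbit_sum M o0 o1 (fun z => @row_free o0 o1 z isT).
rewrite m03 => /(_ p1) <-.
have := @sum_plane_orbit_sum M o2 o3 (fun z => @row_free o2 o3 z isT).
rewrite m20 m23 => /(_ p2) <-.
rewrite -big_split /=.
under eq_bigr do rewrite exchange_big /=.
rewrite exchange_big /=; apply: eq_bigr => z z0.
under eq_bigr do rewrite big_split /=.
rewrite big_split /=; congr (_ + _).
  under eq_bigr do under eq_bigr do rewrite mulmxA vec4M.
  by rewrite sum_torus /= !mul0r !addr0.
under eq_bigr do under eq_bigr do rewrite mulmxA vec4M.
by rewrite sum_torus /= !mul0r !add0r.
Qed.

(** The torus permutes the vectors of each plane of the dual grid of the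
    identity matrix, and it has odd order. *)
Lemma sum_torus_grid_sum1 : 
  \sum_(a1 | qnorm a1 == 1) \sum_(a2 | qnorm a2 == 1) grid_sum (torus_mx a1 a2)
    = grid_sum 1%:M.
Proof.
rewrite -[RHS]mul1r -[X in _ = X * _]sum_qnorm_one mulr_suml; apply: eq_bigr => a /eqP a1.
rewrite -[X in _ = X * _]sum_qnorm_one mulr_suml; apply: eq_bigr => b /eqP b1.
rewrite mul1r /grid_sum; under [RHS]eq_bigr do rewrite !mulmx1.
under [LHS]eq_bigr do rewrite !vec4_torus !qmul0.
have shift (c : k * k) (E : k * k -> k) : qnorm c = 1 ->
    \sum_(z : k * k | z != 0) E (qmul c z) = \sum_(z : k * k | z != 0) E z.
  move=> c1; have c0 : c != 0 by rewrite -qnorm_eq0 c1 oner_eq0.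
  have cK z : qmul (qinv c) (qmul c z) = z.
    rewrite qmulC (qmulC c); exact: qmulK.
  have cVK z : qmul c (qmul (qinv c) z) = z.
    rewrite qmulC (qmulC (qinv c)); exact: qmulKV.
  rewrite [RHS](reindex_onto (qmul c) (qmul (qinv c))) => [|z _]; last exact: cVK.
  by apply: eq_bigl => z; rewrite cK eqxx andbT -!qnorm_eq0 qnormM c1 mul1r.
rewrite !big_split /=; congr (_ + _).
  exact: (shift a (fun w => h (vec4 w 0))).
exact: (shift b (fun w => h (vec4 0 w))).
Qed.

(** * From the average to the constant function *)

Section AnnihilatedFamily.

Variables (J : finType) (x : J -> k) (M : J -> 'M[k]_4).
Hypothesis M_symp : forall j, symplectic (M j).
Hypothesis grid_rel : forall N, symplectic N -> \sum_j x j * grid_sum (M j *m N) = 0.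
Hypothesis grid_sum1 : grid_sum 1%:M != 0.

(* [G] is the average of [grid_sum], as a function of the first minor. *)
Let G (b : k) := orbit_sum b (1 - b) + orbit_sum (1 - b) b.
Let minor01 (N : 'M[k]_4) := minor N o0 o1 o0 o1.

Lemma torus_average_rel N : symplectic N -> \sum_j x j * G (minor01 (M j *m N)) = 0.
Proof.
move=> sN; have GE j : G (minor01 (M j *m N)) = \sum_(a1 | qnorm a1 == 1)
    \sum_(a2 | qnorm a2 == 1) grid_sum (M j *m N *m torus_mx a1 a2).
  by rewrite sum_torus_grid_sum //; apply: symplecticM.
under eq_bigr do rewrite GE mulr_sumr.
rewrite exchange_big big1 //= => a1 a1P; under eq_bigr do rewrite mulr_sumr.
rewrite exchange_big big1 //= => a2 a2P.
under eq_bigr do rewrite -mulmxA; apply: grid_rel.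
by apply: symplecticM => //; apply: torus_symplectic.
Qed.

Lemma G_periodic b : G (b + 1) = G b.
Proof.
have e1 : 1 - (b + 1) = b by rewrite opprD addrCA subrr addr0 oppr_pchar2.
have e2 : b + 1 = 1 - b by rewrite addrC oppr_pchar2.
by rewrite /G e1 e2 addrC.
Qed.

Lemma minor01_1 : minor01 1%:M = 1.
Proof. by rewrite /minor01 /minor !mxE /= mulr0 subr0 mulr1. Qed.

Lemma G1_neq0 : G 1 != 0.
Proof.
have s1 : symplectic 1%:M by rewrite /symplectic mul1mx trmx1 mulmx1.
rewrite -minor01_1 /G /minor01 -(sum_torus_grid_sum s1).
by under eq_bigr do under eq_bigr do rewrite mul1mx; rewrite sum_torus_grid_sum1.
Qed.

(** With [d] the degree of [G], the hypothesis on [grid_sum] passes to [G] of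
    the first minor, then to the [d]-th power of the minor of columns 2, 1, and
    then to the constant 1. *)
Lemma coefficient_sum_eq0 : \sum_j x j = 0.
Proof.
have [P leP PE] := periodic_polynomial G_periodic.
have P0 : P != 0 by apply: contraNneq G1_neq0 => P0; rewrite -PE P0 horner0.
pose d := (size P).-1; have szP : size P = d.+1 by rewrite prednK // size_poly_gt0.
have lead0 : P`_d != 0 by rewrite -[P`_d]/(lead_coef P) lead_coef_eq0.
have s1 : symplectic 1%:M by rewrite /symplectic mul1mx trmx1 mulmx1.
(* If [G] is constant, its relation already is the claim, up to a factor. *)
have [d0|d_gt0] := posnP d.
  have := torus_average_rel s1; rewrite (eq_bigr (fun j => x j * P`_d)).
    by rewrite -mulr_suml => /eqP; rewrite mulf_eq0 (negPf lead0) orbF => /eqP.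
  move=> j _; rewrite -PE; congr (_ * _).
  by rewrite horner_coef szP d0 big_ord1 expr0 mulr1.
have d_bounds : (0 < d < #|k|.-1)%N by rewrite d_gt0 -szP leP.
have minor_rel N : symplectic N ->
    \sum_j x j * minor (M j *m N) o0 o1 o2 o1 ^+ d = 0.
  move=> sN; apply: (mulfI lead0); rewrite mulr0.
  pose Q j := P \Po ((minor01 (M j *m N))%:P + minor (M j *m N) o0 o1 o2 o1 *: 'X).
  have szQ j : (size (Q j) <= #|k|.-1 + d)%N.
    apply: leq_trans (leq_trans leP (leq_addr _ _)); rewrite /Q.
    apply: leq_trans (size_comp_poly_leq _ _) _; rewrite szP /= ltnS.
    rewrite -[X in (_ <= X)%N]muln1 leq_mul2l -subn1 leq_subLR.
    apply/orP; right; apply: leq_trans (size_polyD _ _) _; rewrite geq_max.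
    by rewrite (leq_trans (size_polyC_leq1 _)) // (leq_trans (size_scale_leq _ _)) ?size_polyX.
  have Qd j : (Q j)`_d = P`_d * minor (M j *m N) o0 o1 o2 o1 ^+ d.
    rewrite /Q comp_polyE coef_sum szP big_ord_recr /= big1 ?add0r => [|i _].
      by rewrite coefZ coef_linear_exp // eqxx.
    by rewrite coefZ coef_linear_exp ?(ltnW (ltn_ord i)) // gtn_eqF // mulr0.
  rewrite mulr_sumr; under eq_bigr => j _ do
    rewrite mulrCA -Qd -(sum_horner_weighted d_bounds (szQ j)) mulr_sumr.
  rewrite exchange_big big1 //= => t _.
  under eq_bigr => j _.
    rewrite mulrCA /Q horner_comp hornerD hornerC hornerZ hornerX mulrC PE [_ * t]mulrC.
    rewrite -minor_shear -/(minor01 _) -mulmxA.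
    over.
  rewrite -mulr_suml torus_average_rel ?mul0r //.
  by apply: symplecticM => //; apply: shear_symplectic.
(* [(R j).[c]] is the [d]-th power of the minor of [M j *m slide_mx c]. *)
pose R j := ((minor (M j) o0 o1 o2 o1)%:P + 'X
             + minor (M j) o0 o1 o0 o3 *: 'X^2) ^+ d.
have szR j : (size (R j) <= #|k|.-1 + d)%N.
  apply: leq_trans (size_poly_exp_leq _ _) _.
  have : (size ((minor (M j) o0 o1 o2 o1)%:P + 'X + minor (M j) o0 o1 o0 o3 *: 'X^2)%R <= 3)%N.
    apply: leq_trans (size_polyD _ _) _; rewrite geq_max.
    rewrite (leq_trans (size_scale_leq _ _)) ?size_polyXn // andbT.
    apply: leq_trans (size_polyD _ _) _; rewrite geq_max size_polyX.
    by rewrite (leq_trans (size_polyC_leq1 _)).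
  rewrite -ltnS; case: (size _) => [|s] /= les.
    by rewrite mul0n addn_gt0 d_gt0 orbT.
  case/andP: d_bounds => _ ltd; apply: leq_ltn_trans (_ : d + d < _)%N.
    by rewrite addnn -mul2n leq_mul2r (les : (s <= 2)%N) orbT.
  by rewrite ltn_add2r.
transitivity (\sum_j x j * (R j)`_d).
  by apply: eq_bigr => j _; rewrite coef_central_exp // mulr1.
under eq_bigr => j _ do rewrite -(sum_horner_weighted d_bounds (szR j)) mulr_sumr.
rewrite exchange_big big1 //= => c _.
under eq_bigr => j _.
  rewrite mulrCA horner_exp !hornerD hornerC hornerX hornerZ hornerXn.
  rewrite -minor_slide //.
  over.
by rewrite -mulr_sumr minor_rel ?mulr0 //; apply: slide_symplectic.
Qed.

End AnnihilatedFamily.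

End TorusAverage.
End NormOneTorus.
End Characteristic2.

(** * Dual grids and symplectic bases *)

Section SymplecticFrames.

Variables (F : finFieldType) (f : {skew_symmetric 'rV[F]_4}).
Hypothesis char2 : 2 \in [pchar F].
Hypothesis symp_f : is_psymplectic f.

Lemma form_alt u : f u u = 0.
Proof. by case: symp_f => _ _; apply. Qed.

Lemma form_skew u v : f u v = - f v u.
Proof. by rewrite hermC expr1 mulN1r. Qed.

Definition gram := matrix_of_form f.

Lemma form_gram u v : f u v = (u *m gram *m v^T) 0 0.
Proof.
by rewrite -[LHS](matrix_of_formK f) /form_of_matrix /mxtrace big_ord1 map_mx_id.
Qed.

Lemma gram_rows (E : 'M[F]_4) i j : (E *m gram *m E^T) i j = f (row i E) (row j E).
Proof.
rewrite form_gram -row_mul [LHS]mxE [RHS]mxE; apply: eq_bigr => l _.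
by congr (_ * _); rewrite !mxE.
Qed.

(** The rows of [E] form a symplectic basis for [f]. *)
Definition frame (E : 'M[F]_4) := E *m gram *m E^T = symp_mx F.

Definition frame_line (E : 'M[F]_4) i j := (<[row i E]> + <[row j E]>)%VS.
Definition frame_grid E :=
  points_of (frame_line E o0 o1) :|: points_of (frame_line E o2 o3).

Lemma hyperbolic_pair_free e e' : f e e' = 1 -> \dim (<[e]> + <[e']>) = 2%N.
Proof.
move=> fee'; have ne0 u v : f u v = 1 -> u != 0.
  by move=> fuv; apply: contra_eqN fuv => /eqP->; rewrite linear0l eq_sym oner_eq0.
rewrite dimv_disjoint_sum.
  by rewrite !dim_vline (ne0 _ _ fee') (ne0 e' (- e)) // linearNr -form_skew.
apply/eqP; rewrite -subv0; apply/subvP => v; rewrite memv_cap.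
case/andP=> /vlineP[a ->] /vlineP[b eab]; have /eqP := congr1 (f^~ e') eab.
by rewrite /= !linearZl_LR /= fee' form_alt mulr0 mulr1 => /eqP->; rewrite scale0r mem0v.
Qed.

Lemma nonisotropic_line m : \dim m = 2%N -> ~~ (m <= orthov f m)%VS ->
  exists e e', f e e' = 1 /\ m = (<[e]> + <[e']>)%VS.
Proof.
move=> dim_m /subvPn[u um /mem_orthovPn[v vm fuv]].
exists u, ((f u v)^-1 *: v).
have f1 : f u ((f u v)^-1 *: v) = 1 by rewrite linearZr_LR /= mulVf.
split=> //; apply/esym/eqP; rewrite eqEdim hyperbolic_pair_free // dim_m andbT.
by rewrite subv_add -!memvE um memvZ.
Qed.

(** The line [m] and its orthogonal line are complementary: the projection of
    [w] on [m] is [f w e' *: e - f w e *: e'].  As [f] is nondegenerate, it is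
    nondegenerate on both. *)
Lemma orthov_hyperbolic e e' : f e e' = 1 ->
  let m := (<[e]> + <[e']>)%VS in
  [/\ (m :&: orthov f m = 0)%VS, \dim (orthov f m) = 2%N
    & ~~ (orthov f m <= orthov f (orthov f m))%VS].
Proof.
move=> fee' m; have fe'e : f e' e = - 1 by rewrite form_skew fee'.
have em : e \in m by rewrite memvE addvSl.
have em' : e' \in m by rewrite memvE addvSr.
have cap0 : (m :&: orthov f m = 0)%VS.
  apply/eqP; rewrite -subv0; apply/subvP => v; rewrite memv_cap.
  case/andP=> /memv_addP[_ /vlineP[a ->] [_ /vlineP[b ->] ->]] /mem_orthovP perp.
  have := perp _ em'; have := perp _ em; rewrite !linearDl /= !linearZl_LR /=.
  rewrite fee' fe'e !form_alt !mulr0 add0r addr0 mulr1 mulrN1 => /eqP.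
  by rewrite oppr_eq0 => /eqP-> ->; rewrite !scale0r addr0 mem0v.
have sum1 : (m + orthov f m = fullv)%VS.
  apply/eqP; rewrite eqEsubv subvf; apply/subvP => w _.
  pose w1 := f w e' *: e - f w e *: e'.
  rewrite -[w](subrKC w1) memv_add //; first by rewrite memvB ?memvZ.
  apply/mem_orthovP => _ /memv_addP[_ /vlineP[a ->] [_ /vlineP[b ->] ->]].
  rewrite linearDr /= !linearZr_LR /= /w1 !linearBl /= !linearZl_LR /=.
  by rewrite fee' fe'e !form_alt; ring.
have dimE : \dim (orthov f m) = 2%N.
  have := dimv_disjoint_sum cap0; rewrite sum1 dimvf hyperbolic_pair_free //.
  by rewrite /dim /= mul1n => /eqP; rewrite -[4%N]/(2 + 2)%N eqn_add2l eq_sym => /eqP.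
split=> //; have /subvPn[x xm x0] : ~~ (orthov f m <= 0)%VS.
  by rewrite subv0 -dimv_eq0 dimE.
have /mem_orthovPn[y _ fxy] : x \notin orthov f fullv.
  by case: symp_f => /eqP-> _ _.
have : y \in (m + orthov f m)%VS by rewrite sum1 memvf.
case/memv_addP=> y1 y1m [y2 y2m yE]; apply/subvPn; exists x => //.
apply/mem_orthovPn; exists y2 => //; move: fxy; rewrite yE linearDr /=.
by move/mem_orthovP: xm => -> //; rewrite add0r.
Qed.

Lemma row_mx4 (r0 r1 r2 r3 : 'rV[F]_4) :
  [/\ row o0 (mx4 r0 r1 r2 r3) = r0, row o1 (mx4 r0 r1 r2 r3) = r1,
      row o2 (mx4 r0 r1 r2 r3) = r2 & row o3 (mx4 r0 r1 r2 r3) = r3].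
Proof. by split; apply/rowP => j; rewrite !mxE. Qed.

Lemma dual_grid_frame d : d \in dual_grids f -> exists2 E, frame E & d = frame_grid E.
Proof.
case/imsetP=> m; rewrite inE /Wline => /andP[dim_m]; rewrite dim_m /= => perp_m ->.
have [e0 [e1 [f01 mE]]] := nonisotropic_line (eqP dim_m) perp_m.
have [_ dim_o /(nonisotropic_line dim_o)[e2 [e3 [f23 oE]]]] := orthov_hyperbolic f01.
exists (mx4 e0 e1 e2 e3); have [r0 r1 r2 r3] := row_mx4 e0 e1 e2 e3; last first.
  by rewrite /frame_grid /frame_line r0 r1 r2 r3 -oE -mE.
have perp u v : u \in m -> v \in orthov f m -> f v u = 0.
  by move=> um /mem_orthovP; apply.
have [in0 in1] : e0 \in m /\ e1 \in m by rewrite mE !memvE addvSl addvSr.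
have [in2 in3] : e2 \in orthov f m /\ e3 \in orthov f m.
  by rewrite mE oE !memvE addvSl addvSr.
have perp' u v : u \in m -> v \in orthov f m -> f u v = 0.
  by move=> um vm; rewrite form_skew perp ?oppr0.
apply/matrixP; elim/ord4_ind; elim/ord4_ind; rewrite gram_rows ?(r0, r1, r2, r3) !mxE /=;
  rewrite ?form_alt ?f01 ?f23 //; first [exact: perp | exact: perp' |
  by rewrite form_skew ?f01 ?f23].
Qed.

Lemma frame_dual_grid E : frame E -> frame_grid E \in dual_grids f.
Proof.
move=> frE; have fE i j : f (row i E) (row j E) = symp_mx F i j.
  by rewrite -gram_rows frE.
have f01 : f (row o0 E) (row o1 E) = 1 by rewrite fE !mxE.
have f23 : f (row o2 E) (row o3 E) = 1 by rewrite fE !mxE.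
have [cap0 dim_o _] := orthov_hyperbolic f01.
have orthoE : orthov f (frame_line E o0 o1) = frame_line E o2 o3.
  apply/esym/eqP; rewrite eqEdim dim_o hyperbolic_pair_free // andbT.
  by rewrite subv_add !orthovD !orthov11 !fE !mxE /= eqxx.
apply/imsetP; exists (frame_line E o0 o1); last by rewrite orthoE.
have dim2 := hyperbolic_pair_free f01.
rewrite inE /Wline dim2 /=; apply/negP => sub; move: dim2.
by rewrite -/(frame_line E o0 o1) -(capv_idPl sub) cap0 dimv0.
Qed.

Lemma points_of_act (m : {vspace 'rV[F]_4}) g :
  [set point_act p g | p in points_of m] = points_of (GL_lin g @: m)%VS.
Proof.
apply/setP => p; apply/imsetP/idP => [[p' p'm ->]|].
  by move: p'm; rewrite !inE /=; apply: limgS.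
rewrite inE => pm; exists (point_act p g^-1%g); last first.
  by apply/esym; apply: (actKV (point_action F)).
rewrite inE /=; apply: subv_trans (limgS _ pm) _.
apply/subvP => _ /memv_imgP[_ /memv_imgP[v vm ->] ->].
suff -> : GL_lin g^-1%g (GL_lin g v) = v by [].
rewrite !GL_linE -mulmxA; transitivity (v *m GLval (g * g^-1)%g).
  by rewrite GL_ME.
by rewrite mulgV GL_1E mulmx1.
Qed.

Lemma frame_grid_act E g :
  [set point_act p g | p in frame_grid E] = frame_grid (E *m GLval g).
Proof.
rewrite imsetU !points_of_act /frame_grid /frame_line.
by rewrite !limgD !limg_line !GL_linE -!row_mul.
Qed.

(** [H] as a homogeneous function on vectors, with value 0 at the zero vector,
    which spans no point. *)
Definition vector_value (H : point F -> F) (v : 'rV[F]_4) : F :=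
  oapp H 0 (insub <[v]>%VS).

Lemma vector_valueZ H c v : c != 0 -> vector_value H (c *: v) = vector_value H v.
Proof.
move=> c0; rewrite /vector_value; congr (oapp _ _ (insub _)).
apply/eqP; rewrite eqEsubv -!memvE memvZ ?memv_line //=.
by rewrite -[X in X \in _](scalerK c0) memvZ ?memv_line.
Qed.

(** A point is spanned by [q - 1] vectors, all proportional to one of them. *)
Lemma sum_points_of_line H e e' : f e e' = 1 ->
  \sum_(p in points_of (<[e]> + <[e']>)%VS) H p
    = \sum_(z : F * F | z != 0) vector_value H (z.1 *: e + z.2 *: e').
Proof.
move=> fee'; pose u (z : F * F) := z.1 *: e + z.2 *: e'.
have fu z w : f (u z) (u w) = z.1 * w.2 - z.2 * w.1.
  rewrite /u !linearDl /= !linearDr /= !linearZl_LR /= !linearZr_LR /=.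
  by rewrite !form_alt fee' (form_skew e') fee'; ring.
have u_neq0 z : z != 0 -> u z != 0.
  apply: contraNneq => uz0; have f0 w : f (u z) (u w) = 0 by rewrite uz0 linear0l.
  have := f0 (0, 1); have := f0 (1, 0); rewrite !fu /= !mulr0 !mulr1 subr0 sub0r.
  by case: (z) => z1 z2 /= /eqP; rewrite oppr_eq0 => /eqP -> ->.
have eq_line v z : v != 0 -> z != 0 ->
    (<[u v]> == <[u z]>)%VS = (z.2 * v.1 + z.1 * v.2 == 0).
  move=> v0 z0; apply/eqP/eqP => [uvz|zv0].
    have /vlineP[c uz] : u z \in <[u v]>%VS by rewrite uvz memv_line.
    have := fu z v; rewrite uz linearZl_LR /= form_alt mulr0.
    by rewrite -[X in _ = _ + X](oppr_pchar2 char2) opprK addrC => <-.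
  apply/eqP; rewrite eqEdim !dim_vline !u_neq0 // leqnn andbT -memvE.
  have {zv0} zv : z.2 * v.1 = z.1 * v.2.
    by apply/eqP; rewrite -subr_eq0 (oppr_pchar2 char2) zv0.
  have [z1|z1] := eqVneq z.1 0.
    have z2 : z.2 != 0.
      by apply: contraNneq z0 => z2; case: (z) z1 z2 => ? ? /= -> ->.
    have c1 : v.2 / z.2 * z.1 = v.1 by apply: (mulfI z2); rewrite zv; field.
    have -> : u v = (v.2 / z.2) *: u z by rewrite /u scalerDr !scalerA divfK // c1.
    by rewrite memvZ ?memv_line.
  have c2 : v.1 / z.1 * z.2 = v.2 by apply: (mulfI z1); rewrite -zv; field.
  have -> : u v = (v.1 / z.1) *: u z by rewrite /u scalerDr !scalerA divfK // c2.
  by rewrite memvZ ?memv_line.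
have valueE z : z != 0 -> vector_value H (u z)
    = \sum_(p in points_of (<[e]> + <[e']>)%VS) H p * (val p == <[u z]>%VS)%:R.
  move=> z0; have dim1 : \dim <[u z]> == 1%N by rewrite dim_vline u_neq0.
  rewrite /vector_value insubT /= (bigD1 (Sub <[u z]>%VS dim1)) /=; last first.
    by rewrite inE /= -memvE memv_add ?memvZ ?memv_line.
  rewrite eqxx mulr1 big1 ?addr0 // => p /andP[_ ne_p].
  by rewrite -val_eqE /= in ne_p; rewrite (negPf ne_p) mulr0.
rewrite [RHS](eq_bigr _ valueE) exchange_big /=; apply: eq_bigr => p.
rewrite inE => pm; rewrite -mulr_sumr -[LHS]mulr1; congr (_ * _).
pose w := vpick (val p); have wp : w \in val p := memv_pick _.
have w0 : w != 0 by rewrite vpick0 -dimv_eq0 (eqP (valP p)).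
have pE : val p = <[w]>%VS.
  by apply/esym/eqP; rewrite eqEdim dim_vline w0 (eqP (valP p)) -memvE wp.
have /memv_addP[_ /vlineP[a ->] [_ /vlineP[b ->] wE]] := subvP pm _ wp.
have v0 : (a, b) != 0.
  by apply: contraNneq w0 => -[a0 b0]; rewrite wE a0 b0 !scale0r addr0.
rewrite -[LHS](@sum_proportional F char2 (fun _ _ => 1) (fun _ _ _ _ => erefl) _ v0).
by apply: eq_bigr => z z0; rewrite mul1r pE wE -eq_line.
Qed.

Lemma frame_unit E : frame E -> E \in unitmx.
Proof.
move=> frE; have : E *m (gram *m E^T *m - symp_mx F) = 1%:M.
  by rewrite !mulmxA frE mulmxN symp_mx_sqr opprK.
by case/mulmx1_unit.
Qed.

Lemma frame_quotient_symplectic E0 E :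
  frame E0 -> frame E -> symplectic (E *m invmx E0).
Proof.
move=> fr0 frE; have u0 := frame_unit fr0; rewrite /symplectic -{1}fr0.
by rewrite trmx_mul !mulmxA mulmxKV // -(mulmxA _ E0^T) -trmx_mul mulVmx // trmx1 mulmx1.
Qed.

Lemma sum_frame_grid H E0 E : frame E0 -> frame E ->
  \sum_(p in frame_grid E) H p
    = grid_sum (fun w => vector_value H (w *m E0)) (E *m invmx E0).
Proof.
move=> fr0 frE; have u0 := frame_unit fr0.
have fE i j : f (row i E) (row j E) = symp_mx F i j by rewrite -gram_rows frE.
have f01 : f (row o0 E) (row o1 E) = 1 by rewrite fE !mxE.
have f23 : f (row o2 E) (row o3 E) = 1 by rewrite fE !mxE.
have orth p : p \in points_of (frame_line E o0 o1) ->
    p \notin points_of (frame_line E o2 o3).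
  rewrite !inE => p01; apply/negP => p23; have := valP p.
  have [cap0 _ _] := orthov_hyperbolic f01.
  suff /eqP-> : val p == 0%VS by rewrite dimv0.
  rewrite -subv0 -cap0 subv_cap p01 (subv_trans p23) //.
  by rewrite subv_add !orthovD !orthov11 !fE !mxE /= eqxx.
have disj : [disjoint points_of (frame_line E o0 o1) & points_of (frame_line E o2 o3)].
  by rewrite disjoint_subset; apply/subsetP => p /orth.
rewrite (eq_bigl [in [predU points_of (frame_line E o0 o1) & points_of (frame_line E o2 o3)]]);
  last by move=> p; rewrite !inE.
rewrite bigU //= !sum_points_of_line // /grid_sum -big_split; apply: eq_bigr => z _ /=.
congr (vector_value _ _ + vector_value _ _); rewrite -mulmxA mulmxKV //.
  by apply/rowP => j; rewrite !mxE sum_ord4 !mxE /= !mul0r !addr0.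
by apply/rowP => j; rewrite !mxE sum_ord4 !mxE /= !mul0r !add0r.
Qed.

Lemma unitmx_GL (M : 'M[F]_4) : M \in unitmx -> exists g : {'GL_4[F]}, GLval g = M.
Proof. by move=> uM; exists (Sub M uM); rewrite SubK. Qed.

Lemma Sp_gram (g : {'GL_4[F]}) : GLval g *m gram *m (GLval g)^T = gram -> g \in Sp f.
Proof.
move=> gP; rewrite inE; apply/'forall_forallP => u v; apply/eqP.
by rewrite !form_gram !GL_linE trmx_mul !mulmxA -[in RHS]gP !mulmxA.
Qed.

Lemma gram_Sp (g : {'GL_4[F]}) : g \in Sp f -> GLval g *m gram *m (GLval g)^T = gram.
Proof.
rewrite inE => /'forall_forallP gP; apply/matrixP => i j; rewrite gram_rows.
have := eqP (gP (delta_mx 0 i) (delta_mx 0 j)); rewrite !GL_linE -!rowE => ->.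
by rewrite -matrix_of_formE.
Qed.

Lemma frame_act E (g : {'GL_4[F]}) : frame E -> g \in Sp f -> frame (E *m GLval g).
Proof.
move=> frE gS; rewrite /frame trmx_mul !mulmxA.
by rewrite -(mulmxA E) -(mulmxA E) gram_Sp.
Qed.

(** In coordinates with respect to a frame of [d0], the frame of a dual grid
    becomes a symplectic matrix and the action of [g] becomes right
    multiplication by one; [d0] itself corresponds to the identity matrix. *)
Lemma dual_grid_relation (H : point F -> F) (x : {set point F} -> F) d0 :
    d0 \in dual_grids f -> \sum_(p in d0) H p != 0 ->
    (forall g, g \in Sp f ->
       \sum_(d in dual_grids f) x d * \sum_(p in d) H (point_act p g) = 0) ->
  \sum_(d in dual_grids f) x d = 0.
Proof.
move=> d0D Hd0 rel; have [E0 fr0 d0E] := dual_grid_frame d0D.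
have u0 := frame_unit fr0.
have /fin_all_exists[E frE] (d : {set point F}) :
    exists E, frame E /\ (d \in dual_grids f -> d = frame_grid E).
  have [dD|_] := boolP (d \in dual_grids f); last by exists E0.
  by have [E frE dE] := dual_grid_frame dD; exists E.
have [l l_irr] := exists_irreducible_quadratic char2.
rewrite big_mkcond /=.
pose h w := vector_value H (w *m E0).
have h_hom c w : c != 0 -> h (c *: w) = h w.
  by move=> c0; rewrite /h -scalemxAl vector_valueZ.
apply: (coefficient_sum_eq0 char2 l_irr h_hom (M := fun d => E d *m invmx E0)).
- by move=> d; apply: frame_quotient_symplectic; case: (frE d).
- move=> N sN; have [g gE] : exists g : {'GL_4[F]}, GLval g = invmx E0 *m N *m E0.
    by apply: unitmx_GL; rewrite !unitmx_mul unitmx_inv u0 (symplectic_unit sN).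
  have gS : g \in Sp f.
    apply: Sp_gram; rewrite gE !trmx_mul !mulmxA -(mulmxA _ E0 gram).
    rewrite -(mulmxA _ (E0 *m gram)) fr0.
    rewrite -2!(mulmxA (invmx E0)) (sN : _ *m _ *m _ = _) -fr0 !mulmxA mulVmx // mul1mx.
    by rewrite -mulmxA -trmx_mul mulVmx // trmx1 mulmx1.
  rewrite -[RHS](rel g gS) [RHS]big_mkcond /=; apply: eq_bigr => d _.
  case: ifP => [dD|_]; last by rewrite mul0r.
  have [frd dE] := frE d; congr (_ * _).
  rewrite -(big_imset H) /=; last by move=> p p' _ _; apply: (act_inj (point_action F)).
  rewrite [in RHS](dE dD) frame_grid_act (sum_frame_grid H fr0 (frame_act frd gS)).
  by rewrite gE !mulmxA mulmxK.
by rewrite -(mulmxV u0) /h -(sum_frame_grid H fr0 fr0) -d0E.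
Qed.

End SymplecticFrames.

(** * Radicals and superfluous submodules *)

Section SemisimpleQuotients.

Variables (F : fieldType) (gT : finGroupType) (G : {group gT}) (n : nat).
Variable rG : mx_representation F G n.

Lemma codim1_semisimple_quotient (U V : 'M[F]_n) :
    mxmodule rG U -> mxmodule rG V -> (U <= V)%MS -> \rank V = (\rank U).+1 ->
  semisimple_quotient rG V U.
Proof.
move=> modU modV sUV rankV; split=> //; exists modU, modV; constructor.
have rank1 : \rank <<in_factmod U V>>%MS = 1%N.
  apply/eqP; rewrite genmxE -(eqn_add2r (\rank U)) mxrank_in_factmod.
  by rewrite (addsmx_idPr sUV) rankV.
apply: mxsimple_semisimple; split=> [||W modW _ W0].
- exact: mxmodule1.
- by rewrite -mxrank_eq0 mxrank1 rank1.
rewrite sub1mx /row_full eqn_leq rank_leq_row /=.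
by rewrite {1}rank1 lt0n mxrank_eq0.
Qed.

(** In the semisimple module [V / W], the image of [U] has a complement, say the
    image of [Y].  Then [V <= Y + U], so [Y] is everything and the image of [U],
    which meets that of [Y] trivially, is zero. *)
Lemma superfluous_sub_semisimple (V W U : 'M[F]_n) :
    semisimple_quotient rG V W -> mxmodule rG U -> (U <= V)%MS ->
    (forall X : 'M[F]_n, mxmodule rG X -> (V <= X + U)%MS -> (V <= X)%MS) ->
  (U <= W)%MS.
Proof.
case=> sWV [modW [modV [ss]]] modU sUV superfluous.
have red := mxsemisimple_reducible ss.
set S := section_repr modW modV in red.
set Q := <<in_factmod W V>>%MS in S red.
have UQ : (in_factmod W U <= Q)%MS.
  by rewrite genmxE in_factmodE (in_factmodE _ V) submxMr.
pose A := <<in_submod Q (in_factmod W U)>>%MS.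
have modA : mxmodule S A.
  rewrite (eqmx_module _ (genmxE _)) in_submod_module //.
  by rewrite in_factmod_module addsmx_module.
have [X modX defX dxX] := red A modA (submx1 _).
pose Y := (W + val_factmod (val_submod X))%MS.
have modY : mxmodule rG Y.
  by move: modX; rewrite /mxmodule rstabs_submod rstabs_factmod.
have valE m (Z : 'M_(m, \rank Q)) : val_factmod (val_submod Z) =
    Z *m (val_submod 1%:M *m val_factmod 1%:M) :> 'M_(m, n).
  by rewrite val_factmodE val_submodE -mulmxA.
have sVY : (V <= Y)%MS.
  apply: superfluous modY _; rewrite -(in_factmodsK sWV) addsmx_sub.
  rewrite (submx_trans (addsmxSl W (val_factmod (val_submod X))) (addsmxSl _ _)) /=.
  apply: submx_trans (_ : val_factmod (val_submod (A + X)%MS) <= _)%MS.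
    rewrite val_factmodS -(genmxE (in_factmod W V)) -/Q.
    apply: submx_trans (_ : val_submod 1%:M <= _)%MS; first by rewrite val_submod1.
    by rewrite val_submodS defX.
  rewrite valE addsmxMr -!valE.
  rewrite addsmx_sub; apply/andP; split; last first.
    by apply: submx_trans (addsmxSl _ _); apply: addsmxSr.
  apply: submx_trans (_ : W + val_factmod (in_factmod W (W + U)%MS) <= _)%MS; last first.
    by rewrite in_factmodsK ?addsmxSl // addsmxS // addsmxSl.
  apply: submx_trans (addsmxSr _ _); rewrite val_factmodS in_factmod_addsK.
  by rewrite val_submodE (eqmxMr _ (genmxE _)) -val_submodE in_submodK.
have sAX : (A <= X)%MS.
  apply: submx_trans (submx1 _) _.
  rewrite -val_submodS val_submod1 genmxE in_factmodE (submx_trans (submxMr _ sVY)) //.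
  rewrite addsmxMr -!in_factmodE val_factmodK.
  by rewrite ((in_factmod W W =P 0) _) ?adds0mx ?in_factmod_eq0.
have A0 : A = 0.
  by apply/eqP; rewrite -submx0 -(mxdirect_addsP dxX) sub_capmx submx_refl.
rewrite -in_factmod_eq0 -(in_submodK UQ).
suff -> : in_submod Q (in_factmod W U) = 0 by rewrite linear0.
by apply/eqP; rewrite -submx0 -(genmxE (in_submod _ _)) -/A A0.
Qed.

End SemisimpleQuotients.

(** * The module of dual grids *)

Section F2Embedding.

Variable F : finFieldType.
Hypothesis char2 : 2 \in [pchar F].

Definition F2_val (a : 'F_2) : F := (val a)%:R.

Lemma F2_val0 : F2_val 0 = 0. Proof. by []. Qed.

Lemma F2_valD : {morph F2_val : a b / a + b}.
Proof.
by case=> [[|[|//]] lta] [[|[|//]] ltb]; rewrite /F2_val /= ?addr0 ?add0r ?addrr_pchar2.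
Qed.

Lemma F2_valM : {morph F2_val : a b / a * b}.
Proof.
by case=> [[|[|//]] lta] [[|[|//]] ltb]; rewrite /F2_val /= ?mulr0 ?mul0r ?mulr1.
Qed.

Lemma F2_val_sum (I : Type) r (P : pred I) E :
  F2_val (\sum_(i <- r | P i) E i) = \sum_(i <- r | P i) F2_val (E i).
Proof. exact: (big_morph _ F2_valD F2_val0). Qed.

Lemma F2_val_eq0 a : (F2_val a == 0) = (a == 0).
Proof. by case: a => [[|[|//]] lta]; rewrite /F2_val /= ?eqxx ?oner_eq0. Qed.

Lemma F2_addrr (a : 'F_2) : a + a = 0.
Proof. by apply: val_inj; case: a => [[|[|//]] lta]. Qed.

End F2Embedding.

Section DualGridModule.

Variables (F : finFieldType) (f : {skew_symmetric 'rV[F]_4}).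
Hypothesis char2 : 2 \in [pchar F].
Hypothesis symp_f : is_psymplectic f.

Local Notation rG := (point_module f).
Local Notation D := (dual_grid_module f).
Local Notation DG := (dual_grids f).
Local Notation act g d := [set point_act p g | p in d].

Lemma charv_mulE (d : {set point F}) m (K : 'M['F_2]_(_, m)) j :
  (charv 'F_2 d *m K) 0 j = \sum_(p in d) K (enum_rank p) j.
Proof.
rewrite mxE (reindex_onto enum_rank enum_val) => [|i _]; last exact: enum_valK.
rewrite [RHS]big_mkcond; apply: eq_big => [p|p _]; first by rewrite enum_rankK eqxx.
by rewrite mxE enum_rankK; case: ifP; rewrite (mul1r, mul0r).
Qed.

Lemma charv_coset d (g : {'GL_4[F]}) :
  charv 'F_2 d *m rG (coset 'Z('GL_4[F]) g) = charv 'F_2 (act g d).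
Proof.
rewrite charv_permod; last by apply: mem_quotient; rewrite inE.
by congr (charv _ _); rewrite /= setactE; apply: eq_imset => p; apply: PGL_actionE.
Qed.

Lemma PSp_coset a : a \in PSp f -> exists2 g, g \in Sp f & a = coset 'Z('GL_4[F]) g.
Proof. by case/morphimP => g _ gS ->; exists g. Qed.

Lemma coset_PSp (g : {'GL_4[F]}) : g \in Sp f -> coset 'Z('GL_4[F]) g \in PSp f.
Proof. exact: mem_quotient. Qed.

Lemma dual_grids_act d g : d \in DG -> g \in Sp f -> act g d \in DG.
Proof.
move=> dD gS; have [E frE ->] := dual_grid_frame char2 symp_f dD.
by rewrite frame_grid_act; apply: frame_dual_grid => //; apply: frame_act.
Qed.

Lemma charv_sub d : d \in DG -> (charv 'F_2 d <= D)%MS.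
Proof. by move=> dD; apply: (sumsmx_sup d) => //; apply: cyclic_mx_id. Qed.

Lemma dual_grid_module_sub (W : 'M['F_2]_#|{: point F}|) : mxmodule rG W ->
  (forall d, d \in DG -> (charv 'F_2 d <= W)%MS) -> (D <= W)%MS.
Proof.
by move=> modW sub; apply/sumsmx_subP => d dD; apply: cyclic_mx_sub => //; apply: sub.
Qed.

Lemma dual_grid_module_module : mxmodule rG D.
Proof. by apply: sumsmx_module => d _; apply: cyclic_mx_module. Qed.

(** The functional [H] is a column of [cokermx W] on which some dual grid does
    not vanish; [W] is stable under [g] and killed by [H], which gives the
    relation needed for [dual_grid_relation]. *)
Lemma proper_submodule_relation (W : 'M['F_2]_#|{: point F}|) (x : {set point F} -> 'F_2) :
    mxmodule rG W -> ~~ (D <= W)%MS ->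
    ((\sum_(d in DG) x d *: charv 'F_2 d)%R <= W)%MS ->
  \sum_(d in DG) x d = 0.
Proof.
move=> modW nDW xW; have [d0 d0D d0W] : exists2 d, d \in DG & ~~ (charv 'F_2 d <= W)%MS.
  apply/exists_inP; apply: contraR nDW => /exists_inPn sub.
  by apply: dual_grid_module_sub => // d /sub; rewrite negbK.
have [j Hj] : exists j, (charv 'F_2 d0 *m cokermx W) 0 j != 0.
  by move: d0W; rewrite submxE => /rV0Pn.
pose H p := F2_val F (cokermx W (enum_rank p) j).
apply/eqP; rewrite -(F2_val_eq0 F) F2_val_sum //; apply/eqP.
apply: (dual_grid_relation char2 symp_f (H := H) d0D).
  by rewrite -F2_val_sum // -charv_mulE F2_val_eq0.
move=> g gS; have /mxmoduleP/(_ _ (coset_PSp gS)) := modW.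
move/(submx_trans (submxMr _ xW)); rewrite submxE => /eqP/rowP/(_ j).
rewrite !mulmx_suml summxE [X in _ = X]mxE => /(congr1 (F2_val F)).
rewrite F2_val_sum // F2_val0 => xH; rewrite -[RHS]xH; apply: eq_bigr => d dD.
rewrite -!scalemxAl mxE charv_coset charv_mulE F2_valM // F2_val_sum //; congr (_ * _).
rewrite big_imset //= => p p' _ _; exact: (act_inj (point_action F)).
Qed.

Lemma dual_grids_neq0 : exists d, d \in DG.
Proof.
have /existsP[u /existsP[v fuv]] : [exists u, [exists v, f u v != 0]].
  apply: contraT => /existsPn f0; case: symp_f => /eqP rad0 _ _.
  have : (delta_mx 0 0 : 'rV[F]_4) \in orthov f fullv.
    apply/mem_orthovP => v _; apply/eqP; have /existsPn/(_ v) := f0 (delta_mx 0 0).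
    by rewrite negbK.
  rewrite rad0 memv0 => /eqP/rowP/(_ 0); rewrite !mxE /= => /eqP.
  by rewrite oner_eq0.
have f1 : f u ((f u v)^-1 *: v) = 1 by rewrite linearZr_LR /= mulVf.
have dim2 := hyperbolic_pair_free char2 symp_f f1.
have [cap0 _ _] := orthov_hyperbolic char2 symp_f f1.
pose m := (<[u]> + <[(f u v)^-1 *: v]>)%VS.
exists (points_of m :|: points_of (orthov f m)); apply: imset_f.
rewrite inE /Wline /m dim2 /=; apply/negP => sub; move: dim2.
by rewrite -(capv_idPl sub) cap0 dimv0.
Qed.

Section Differences.

Variable d0 : {set point F}.
Hypothesis d0D : d0 \in DG.

(** As [F_2] has characteristic two, the sum of any two dual grids is the sum of
    two generators, so that the choice of [d0] does not matter. *)
Definition difference_module : 'M['F_2]_#|{: point F}| :=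
  (\sum_(d in DG) <<(charv 'F_2 d + charv 'F_2 d0)%R>>)%MS.
Local Notation U := difference_module.

Lemma difference_sub d1 d2 : d1 \in DG -> d2 \in DG ->
  ((charv 'F_2 d1 + charv 'F_2 d2)%R <= U)%MS.
Proof.
have sub d : d \in DG -> ((charv 'F_2 d + charv 'F_2 d0)%R <= U)%MS.
  by move=> dD; apply: (sumsmx_sup d) => //; rewrite genmxE.
move=> /sub d1U /sub d2U; have := addmx_sub d1U d2U.
have d00 : charv 'F_2 d0 + charv 'F_2 d0 = 0.
  by rewrite -[charv _ _]scale1r -scalerDl F2_addrr scale0r.
by rewrite addrACA d00 addr0.
Qed.

Lemma difference_module_sub : (U <= D)%MS.
Proof.
apply/sumsmx_subP => d dD; rewrite genmxE.
by apply: addmx_sub; apply: charv_sub.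
Qed.

Lemma difference_module_module : mxmodule rG U.
Proof.
apply/mxmoduleP => a /PSp_coset[g gS ->]; rewrite sumsmxMr; apply/sumsmx_subP => d dD.
rewrite (eqmxMr _ (genmxE _)) mulmxDl !charv_coset.
by apply: difference_sub; apply: dual_grids_act.
Qed.

Lemma charv_line_difference d : d \in DG -> (charv 'F_2 d <= charv 'F_2 d0 + U)%MS.
Proof.
move=> dD; rewrite -[charv _ d](addrK (charv 'F_2 d0)) addmx_sub //.
  exact: submx_trans (difference_sub dD d0D) (addsmxSr _ _).
by rewrite eqmx_opp addsmxSl.
Qed.

Lemma module_line_difference : (D <= charv 'F_2 d0 + U)%MS.
Proof.
apply: dual_grid_module_sub => [|d]; last exact: charv_line_difference.
apply/mxmoduleP => a aG; rewrite addsmxMr addsmx_sub.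
have [g gS aE] := PSp_coset aG; rewrite {1}aE charv_coset.
rewrite charv_line_difference ?dual_grids_act //=.
by apply: submx_trans (addsmxSr _ _); apply: (mxmoduleP difference_module_module).
Qed.

Lemma sum_indicator_d0 (V : nmodType) (v : {set point F} -> V) :
  \sum_(d in DG) v d *+ (d == d0) = v d0.
Proof.
by rewrite (bigD1 d0) //= eqxx big1 ?addr0 // => d /andP[_ /negPf->].
Qed.

Lemma difference_coefficients (u : 'rV_#|{: point F}|) : (u <= U)%MS ->
  exists x : {set point F} -> 'F_2,
    \sum_(d in DG) x d *: charv 'F_2 d = u /\ \sum_(d in DG) x d = 0.
Proof.
case/sub_sumsmxP => c ->.
have /fin_all_exists[a aE] (d : {set point F}) : exists a : 'F_2,
    c d *m <<(charv 'F_2 d + charv 'F_2 d0)%R>>%MS = a *: (charv 'F_2 d + charv 'F_2 d0).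
  by apply/sub_rVP; rewrite -(genmxE (_ + _)%R) submxMl.
pose s := \sum_(d in DG) a d; exists (fun d => a d + s *+ (d == d0)).
split; last by rewrite big_split /= -/s (sum_indicator_d0 (fun=> s)) F2_addrr.
under eq_bigr do rewrite scalerDl -scalerMnl.
rewrite big_split /= (sum_indicator_d0 (fun=> _)); under [RHS]eq_bigr do rewrite aE scalerDr.
by rewrite big_split /= -scaler_suml.
Qed.

(** Otherwise [d0] is the sum of an element of [W] and an element of [U]; the
    element of [W] then is a combination of dual grids with coefficient sum 1. *)
Lemma difference_superfluous (W : 'M['F_2]_#|{: point F}|) :
  mxmodule rG W -> (D <= W + U)%MS -> (D <= W)%MS.
Proof.
move=> modW DWU; apply: contraT => nDW.
have /sub_addsmxP[[w u] /= d0E] := submx_trans (charv_sub d0D) DWU.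
have [x [xE x0]] := difference_coefficients (submxMl u U).
pose y d : 'F_2 := (d == d0)%:R - x d.
have yW : ((\sum_(d in DG) y d *: charv 'F_2 d)%R <= W)%MS.
  under eq_bigr do rewrite scalerBl scaler_nat.
  by rewrite sumrB sum_indicator_d0 xE d0E addrK submxMl.
have := proper_submodule_relation modW nDW yW.
by rewrite /y sumrB x0 subr0 (sum_indicator_d0 (fun=> 1)) => /eqP; rewrite oner_eq0.
Qed.

Lemma charv_neq0 : charv 'F_2 d0 != 0.
Proof.
have [E frE d0E] := dual_grid_frame char2 symp_f d0D.
have r0 : row o0 E != 0.
  apply: contraTneq (frame_unit frE) => r0; apply/negP => uE.
  have : row o0 (E *m invmx E) = 0 by rewrite row_mul r0 mul0mx.
  by rewrite mulmxV // => /rowP/(_ o0)/eqP; rewrite !mxE oner_eq0.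
have dim1 : \dim <[row o0 E]> == 1%N by rewrite dim_vline r0.
pose p : point F := Sub <[row o0 E]>%VS dim1.
apply/eqP => /rowP/(_ (enum_rank p))/eqP; rewrite !mxE enum_rankK d0E !inE /=.
by rewrite addvSl oner_eq0.
Qed.

Lemma rank_dual_grid_module : \rank D = (\rank U).+1.
Proof.
apply/eqP; rewrite eqn_leq; apply/andP; split.
  apply: leq_trans (mxrankS module_line_difference) _.
  apply: leq_trans (mxrank_adds_leqif _ _) _.
  by rewrite -[leqRHS]add1n leq_add2r rank_leq_row.
rewrite ltn_neqAle mxrankS ?difference_module_sub // andbT.
apply: contraNneq charv_neq0 => rankUD; rewrite -submx0.
apply: submx_trans (charv_sub d0D) (difference_superfluous (mxmodule0 rG _) _).
by rewrite adds0mx -(mxrank_leqif_sup difference_module_sub) rankUD.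
Qed.

End Differences.
End DualGridModule.

Theorem theorem1p4 (n : nat) (F : finFieldType)
    (f : {skew_symmetric 'rV[F]_4})
    (cardF : #|F| = (2 ^ n)%N) (q_gt2 : (2 < 2 ^ n)%N)
    (symp_f : is_psymplectic f) :
  exists U : 'M['F_2]_#|{: point F}|,
    [/\ is_radical (point_module f) (dual_grid_module f) U,
        \rank (dual_grid_module f) = (\rank U).+1
      & forall d1 d2 : {set point F},
          d1 \in dual_grids f -> d2 \in dual_grids f ->
          ((charv 'F_2 d1 + charv 'F_2 d2)%R <= U)%MS].
Proof.
have char2 : 2 \in [pchar F] by apply: card_finPcharP cardF _.
have [d0 d0D] := dual_grids_neq0 char2 symp_f.
exists (difference_module f d0).
have rankD := rank_dual_grid_module char2 symp_f d0D.
have modU := difference_module_module char2 symp_f d0D.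
have sUD := difference_module_sub d0D.
split=> //; last by move=> d1 d2; apply: difference_sub.
split; first exact: codim1_semisimple_quotient (dual_grid_module_module f) _ _.
move=> W ssW; apply: superfluous_sub_semisimple ssW modU sUD _ => X modX.
exact: difference_superfluous.
Qed.
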